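(* Let $X$ and $Y$ be pseudocompact Tychonoff spaces and let $\Phi: X\times Y\to\mathbb{R}$ be a separately continuous function. Define $$\varphi_X: X\to C_p(Y),\ \varphi_X(x)(y)=\Phi(x,y),\qquad \varphi_Y: Y\to C_p(X),\ \varphi_Y(y)(x)=\Phi(x,y).$$ The following conditions are equivalent: (1) there is a dense $G_\delta$ subset $D$ of $Y$ such that $\Phi$ is (jointly) continuous at every point $(x,y)\in X\times D$; (2) the function $\Phi$ is quasi-continuous; (3) the closure of $\varphi_X(X)$ in $C_p(Y)$ is compact; (4) $\varphi_X(X)$ is an Eberlein compactum; (5) $\Phi$ extends to a separately continuous function $\beta X\times Y\to\mathbb{R}$; (6) $\Phi$ extends to a separately continuous function $\beta X\times\beta Y\to\mathbb{R}$; (7) $\Phi$ extends to a separately continuous function $X\times\beta Y\to\mathbb{R}$; (8) $\varphi_Y(Y)$ is an Eberlein compactum; (9) the closure of $\varphi_Y(Y)$ in $C_p(X)$ is compact; (10) there is a dense $G_\delta$ subset $E$ of $X$ such that $\Phi$ is (jointly) continuous at every point $(x,y)\in E\times Y$.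
   Context: A Tychonoff space $X$ is pseudocompact if every continuous function $X\to\mathbb{R}$ is bounded. $\beta X$ is the Stone–Čech compactification of $X$, with $X\subset\beta X$. $C_p(X)$ is the space of continuous functions $X\to\mathbb{R}$ with the topology of pointwise convergence. A function $\Phi: X\times Y\to\mathbb{R}$ is separately continuous if $\Phi(\cdot,y)$ and $\Phi(x,\cdot)$ are continuous for all $y\in Y$ and $x\in X$. A function $f: Z\to\mathbb{R}$ is quasi-continuous if for every $z\in Z$, every neighborhood $O$ of $f(z)$ and every neighborhood $W$ of $z$ there is a non-empty open $U\subset W$ with $f(U)\subset O$. An Eberlein compactum is a compact space homeomorphic to a weakly compact subset of a Banach space. *)

(* Defs.v *)
From mathcomp Require Import all_boot all_order all_algebra.
From mathcomp Require Import all_classical all_reals all_analysis.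

Set Implicit Arguments.
Unset Strict Implicit.
Unset Printing Implicit Defensive.

Import Order.TTheory GRing.Theory Num.Theory.
Import numFieldNormedType.Exports.

Local Open Scope classical_set_scope.
Local Open Scope ring_scope.

Definition tychonoff_space (X : topologicalType) : Prop :=
  hausdorff_space X /\ completely_regular_space X.

Definition pseudocompact (R : realType) (X : topologicalType) : Prop :=
  forall f : X -> R, continuous f -> exists M : R, forall x, `|f x| <= M.

Definition Cp (R : realType) (X : topologicalType) : topologicalType :=
  initial_topology (fun f : continuousType X R => (f : {ptws X -> R})).

Definition separately_continuous (R : realType) (X Y : topologicalType)
    (Phi : X * Y -> R) : Prop :=
  (forall y, continuous (fun x => Phi (x, y))) /\
  (forall x, continuous (fun y => Phi (x, y))).

Definition quasi_continuous (Z T : topologicalType) (f : Z -> T) : Prop :=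
  forall (z : Z) (O : set T) (W : set Z), nbhs (f z) O -> nbhs z W ->
    exists U : set Z, [/\ open U, U !=set0, U `<=` W & f @` U `<=` O].

Definition homeomorphic (S T : topologicalType) : Prop :=
  exists (f : S -> T) (g : T -> S),
    [/\ continuous f, continuous g, cancel f g & cancel g f].

(* V with the coarsest topology making all norm-continuous functionals
   continuous. *)
Definition weak_space (R : realType) (V : normedModType R) : topologicalType :=
  sup_topology (fun f : {f : {linear V -> R^o} | continuous f} =>
    Topological.class (initial_topology (sval f : V -> R))).

Definition eberlein_compactum (R : realType) (K : topologicalType) : Prop :=
  compact [set: K] /\
  exists (V : completeNormedModType R) (A : set (weak_space V)),
    compact A /\ homeomorphic K (set_type A).

(* The Stone-Cech compactification is realized as the closure of the image of
   X in the Tychonoff cube [0, 1]^I, with I the set of continuous functions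
   X -> [0, 1].  The ambient product is R^I, in which the cube is closed. *)
Section stone_cech.
Context (R : realType) (X : topologicalType).

Definition unit_function : Type :=
  {f : X -> R | continuous f /\ forall x, 0 <= f x <= 1}.

Definition cube_eval (x : X) : {ptws unit_function -> R} :=
  fun f => sval f x.

Definition stone_cech : topologicalType :=
  set_type (closure (range cube_eval)).

Lemma cube_eval_closure (x : X) : cube_eval x \in closure (range cube_eval).
Proof. by apply/mem_set; apply: subset_closure; exists x. Qed.

Definition to_stone_cech (x : X) : stone_cech :=
  exist _ (cube_eval x) (cube_eval_closure x).

End stone_cech.

Arguments to_stone_cech R {X} x.

Section partial_maps.
Context (R : realType) (X Y : topologicalType) (Phi : X * Y -> R).
Hypothesis scPhi : separately_continuous Phi.

Definition phiX (x : X) : Cp R Y := mkcts (scPhi.2 x).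

Definition phiY (y : Y) : Cp R X := mkcts (scPhi.1 y).

End partial_maps.

(* Main.v *)
From HB Require Import structures.
Require Import Defs.
From mathcomp Require Import all_boot all_order all_algebra.
From mathcomp Require Import all_classical all_reals all_analysis borel_hierarchy.
From mathcomp Require Import lra.

(* All conditions are equivalent to the following one ([limit_closed]): every
   function that is a pointwise limit of the functions Phi(x, -) along a filter
   on X is continuous on Y.

   Pseudocompactness is used in two forms: a sequence of nonempty open sets has
   a cluster point, and, given countably many continuous functions h_k and a
   family of points y_i, the limits of h_k(y_i) along an ultrafilter are all
   attained at a single point.  With this replacement for compactness,
   - Grothendieck's double limit argument shows that [limit_closed] is symmetric
     in X and Y;
   - Namioka's argument gives a dense G_delta set E of points of X at which
     x |-> Phi(x, -) is continuous for the uniform norm;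
   - a limit of the functions Phi(x, -) is the limit of a sequence Phi(a_n, -)
     with a_n in E; it is attained at any cluster point of neighborhoods of the
     a_n on which Phi varies by at most 1/n, so phi_X(X) is compact;
   - bounded pointwise convergent sequences of continuous functions converge
     weakly in the space of bounded functions (Simons' inequality), so that,
     once Phi is made bounded, phi_X(X) is weakly compact.
   If Phi is quasi-continuous and a limit g of the Phi(x, -) jumps at y0, one
   builds open sets U_n, V_n such that Phi is large on U_i x V_n for i <= n and
   small on U_n x V_i for i < n; cluster points of both sequences give a
   contradiction. *)

Import Order.TTheory GRing.Theory Num.Theory.
Import numFieldNormedType.Exports.

Local Open Scope classical_set_scope.
Local Open Scope ring_scope.

Set Implicit Arguments.
Unset Strict Implicit.
Unset Printing Implicit Defensive.

(** * Pseudocompact spaces *)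

Lemma dist_eps_eq (R : realFieldType) (a b : R) :
  (forall e : R, 0 < e -> `|a - b| <= e) -> a = b.
Proof.
move=> H; apply/eqP; rewrite -subr_eq0 -normr_le0.
by apply/ler_addgt0Pl => e e0; rewrite addr0; exact: H.
Qed.

Lemma vanishing_seq (R : realType) : exists2 d : nat -> R, forall n, 0 < d n &
  forall e : R, 0 < e -> exists N, forall n, (N <= n)%N -> d n < e.
Proof.
exists harmonic; first exact: harmonic_gt0.
move=> e e0; exists (Num.truncn e^-1) => n Nn; rewrite /harmonic invf_plt ?posrE//.
by apply: lt_le_trans (truncnS_gt _) _; rewrite ler_nat ltnS.
Qed.

Lemma cvg_dist (R : realType) (I : Type) (F : set_system I) (FF : Filter F)
    (u : I -> R) (l : R) :
  u @ F --> l -> forall e : R, 0 < e -> F [set i | `|u i - l| < e].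
Proof.
move=> /cvgrPdist_lt ul e e0; apply: filterS (ul e e0) => i /=.
by rewrite distrC.
Qed.

Lemma dist_cvg (R : realType) (I : Type) (F : set_system I) (FF : Filter F)
    (u : I -> R) (l : R) :
  (forall e : R, 0 < e -> F [set i | `|u i - l| < e]) -> u @ F --> l.
Proof.
move=> H; apply/cvgrPdist_lt => e e0; apply: filterS (H e e0) => i /=.
by rewrite distrC.
Qed.

Lemma continuous_dist (R : realType) (X : topologicalType) (f : X -> R) :
  continuous f -> forall x (e : R), 0 < e -> nbhs x [set z | `|f z - f x| < e].
Proof. by move=> fc x; exact: cvg_dist (fc x). Qed.

Lemma ultra_bounded_cvg (R : realType) (I : Type) (F : set_system I)
    (UF : UltraFilter F) (u : I -> R) (M : R) :
  (forall i, `|u i| <= M) -> exists l : R, u @ F --> l.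
Proof.
move=> uM.
have FF : ProperFilter F by exact: ultra_proper.
have cpt : compact (`[- M, M]%classic : set R) by exact: segment_compact.
have uIM : (u @ F) `[- M, M]%classic.
  by apply: (@filterE _ F) => i /=; rewrite in_itv/= -ler_norml; exact: uM.
have [l [_ clul]] := cpt (u @ F) _ uIM; exists l => W Wl.
have [//|FW] := in_ultra_setVsetC (u @^-1` W) UF.
by have [x [/= nWx Wx]] := clul (~` W) W FW Wl.
Qed.

Lemma completely_regular_bump (R : realType) (X : topologicalType)
    (crX : completely_regular_space X) (x : X) (U : set X) :
  nbhs x U -> exists p : X -> R, [/\ continuous p, forall z, 0 <= p z <= 1,
    p x = 1 & forall z, ~ U z -> p z = 0].
Proof.
rewrite nbhsE => -[V [oV Vx] VU].
have /(uniform_separatorP (R := R))[f [cf f01 fx fV]] :=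
  crX x (~` V) (open_closedC oV) (fun h => h Vx).
exists (fun z => 1 - f z); split.
- by move=> z; apply: cvgB; [exact: cvg_cst | exact: cf].
- move=> z; have : `[0, 1]%classic (f z) by apply: f01; exists z.
  by rewrite /= in_itv/= => /andP[f0 f1]; rewrite subr_ge0 f1 gerBl.
- by have /= -> := fx (f x) (ex_intro2 _ _ x erefl erefl); rewrite subr0.
- move=> z nUz; have /= -> := fV (f z) (ex_intro2 _ _ z (fun h => nUz (VU _ h)) erefl).
  by rewrite subrr.
Qed.

(** Near each point the sum has a fixed number of terms, so it agrees there with a continuous finite
    sum. *)
Lemma locally_finite_sum_continuous (R : realType) (X : topologicalType)
    (b : nat -> X -> R) (bc : forall n, continuous (b n)) :
  (forall x : X, exists N : nat,
    nbhs x [set z | forall n, (N <= n)%N -> b n z = 0]) ->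
  exists f : X -> R, continuous f /\ forall N x,
    (forall n, (N <= n)%N -> b n x = 0) -> f x = \sum_(0 <= n < N) b n x.
Proof.
move=> lf.
have /choice[N HN] : forall x, exists N : nat, forall n, (N <= n)%N -> b n x = 0.
  by move=> x; have [N /nbhs_singleton] := lf x; exists N.
pose f x := \sum_(0 <= n < N x) b n x.
have sumE M K x : (forall n, (M <= n)%N -> b n x = 0) -> (M <= K)%N ->
    \sum_(0 <= n < K) b n x = \sum_(0 <= n < M) b n x.
  move=> HM MK; rewrite (big_cat_nat (n := M))//= [X in _ + X]big1_seq ?addr0//.
  by move=> n; rewrite mem_index_iota => /andP[_ /andP[/HM]].
have fE M x : (forall n, (M <= n)%N -> b n x = 0) ->
    f x = \sum_(0 <= n < M) b n x.
  move=> HM; have [MN|/ltnW NM] := leqP M (N x); first exact: sumE.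
  by rewrite /f (sumE _ _ _ (HN x) NM).
exists f; split => // x.
have [M nM] := lf x.
have Mx := nbhs_singleton nM.
apply: (@cvg_trans _ ((fun z => \sum_(0 <= n < M) b n z) @ x)).
  apply: near_eq_cvg; near=> z; apply: esym; apply: fE.
  by near: z.
rewrite (fE _ _ Mx).
by apply: cvg_big => [|i _]; [exact: add_continuous | exact: bc].
Unshelve. all: by end_near. Qed.

(** Without a cluster point the sets [U n] are locally finite, and the sum of the [n%:R * p n], with
    [p n] a bump at [x n] vanishing off [U n], is continuous and unbounded. *)
Lemma pseudocompact_cluster (R : realType) (X : topologicalType)
    (crX : completely_regular_space X) (pX : pseudocompact R X)
    (x : nat -> X) (U : nat -> set X) :
  (forall n, nbhs (x n) (U n)) ->
  exists z : X, forall W : set X, nbhs z W ->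
    forall N, exists2 n, (N <= n)%N & U n `&` W !=set0.
Proof.
move=> Ux; apply: contrapT => /forallNP nocl.
have /choice[p /all_and4[pc p01 px pU]] : forall n, exists p : X -> R,
    [/\ continuous p, forall z, 0 <= p z <= 1, p (x n) = 1 &
        forall z, ~ U n z -> p z = 0].
  by move=> n; exact: completely_regular_bump.
have {}nocl (z : X) : exists (W : set X) N, nbhs z W /\ forall n, (N <= n)%N -> U n `&` W = set0.
  have /existsNP[W /not_implyP[Wz /existsNP[N HN]]] := nocl z.
  exists W, N; split => // n Nn; rewrite -subset0 => t Ut.
  by apply: HN; exists n => //; exists t.
have [|z|f [fc fE]] := @locally_finite_sum_continuous R X (fun n z => n%:R * p n z).
- by move=> n z; apply: cvgM; [exact: cvg_cst | exact: pc].
- have [W [N [Wz WN]]] := nocl z.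
  exists N; apply: filterS Wz => t Wt n Nn; rewrite pU ?mulr0// => Ut.
  by have : (U n `&` W) t by []; rewrite WN.
have [M fM] := pX _ fc.
have fx n : n%:R <= f (x n).
  have [W [N [Wz WN]]] := nocl (x n).
  have HK m : (maxn N n.+1 <= m)%N -> m%:R * p m (x n) = 0.
    rewrite geq_max => /andP[Nm _]; rewrite pU ?mulr0// => Ut.
    have : (U m `&` W) (x n) by split=> //; exact: nbhs_singleton.
    by rewrite WN.
  have nK : (n < maxn N n.+1)%N by rewrite leq_maxr.
  rewrite (fE _ _ HK) big_mkord (bigD1 (Ordinal nK))//= px mulr1 lerDl.
  by apply: sumr_ge0 => i _; rewrite mulr_ge0//; have /andP[] := p01 i (x n).
have := fx (Num.truncn M).+1; rewrite leNgt => /negP; apply.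
apply: le_lt_trans (ler_norm _) _; apply: le_lt_trans (fM _) _.
exact: truncnS_gt.
Qed.

(** The set where [h 0], ..., [h m] are within [d m] of their limits is a neighborhood of some
    [y i]; a cluster point of these sets takes all the limit values. Only the values of the [h k]
    converge to those at [z]; the points [y i] themselves need not converge. *)
Lemma pseudocompact_ultra_limit (R : realType) (Y : topologicalType)
    (crY : completely_regular_space Y) (pY : pseudocompact R Y)
    (I : Type) (F : set_system I) (UF : UltraFilter F)
    (y : I -> Y) (h : nat -> Y -> R) :
  (forall k, continuous (h k)) ->
  exists z, forall k, h k (y i) @[i --> F] --> h k z.
Proof.
move=> hc.
have FF : ProperFilter F by exact: ultra_proper.
have /choice[c cP] : forall k, exists l : R, h k (y i) @[i --> F] --> l.
  by move=> k; have [M HM] := pY _ (hc k); apply: ultra_bounded_cvg.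
have [d d0 dlt] := vanishing_seq R.
pose V m : set Y := [set z | forall k : 'I_m.+1, `|h k z - c k| < d m].
have /choice[v vV] : forall m, exists v : Y, nbhs v (V m).
  move=> m.
  have : F [set i | forall k : 'I_m.+1, `|h k (y i) - c k| < d m].
    by apply: filter_forall => k; apply: (cvg_dist FF (cP k)); exact: d0.
  move=> /filter_ex[i Hi]; exists (y i); apply: filter_forall => k.
  have e0 : 0 < d m - `|h k (y i) - c k| by rewrite subr_gt0; exact: Hi.
  apply: filterS (continuous_dist (hc k) _ e0) => t /= ht.
  by have := ler_distD (h k (y i)) (h k t) (c k); lra.
have [z zP] := pseudocompact_cluster crY pY vV.
exists z => k; suff -> : h k z = c k by [].
apply/dist_eps_eq => e e0.
have e20 : 0 < e / 2 by rewrite divr_gt0.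
have [N HN] := dlt _ e20.
have [n] := zP _ (continuous_dist (hc k) _ e20) (maxn k N).
rewrite geq_max => /andP[kn /HN ne] [t [Vt /= ht]].
have /= ct := Vt (Ordinal (kn : (k < n.+1)%N)).
have := ler_distD (h k t) (h k z) (c k).
rewrite (distrC _ (h k t)); lra.
Qed.

(** * Pointwise limits of rows of a separately continuous function *)

Lemma cvg_to_eq (R : realType) (I : Type) (F : set_system I)
    (FF : ProperFilter F) (u : I -> R) (l l' : R) :
  u @ F --> l -> u @ F --> l' -> l = l'.
Proof. by move=> ul ul'; exact: (cvg_unique _ ul ul'). Qed.

Lemma dependent_choice_seq (T : Type) (t0 : T)
    (P : nat -> (nat -> T) -> T -> Prop) :
  (forall n u v t, (forall i, (i < n)%N -> u i = v i) -> P n u t -> P n v t) ->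
  (forall n u, (forall i, (i < n)%N -> P i u (u i)) -> exists t, P n u t) ->
  exists u, forall n, P n u (u n).
Proof.
move=> Ploc Pex.
have /choice[sel selP] : forall nu : nat * (nat -> T), exists t,
    (exists t', P nu.1 nu.2 t') -> P nu.1 nu.2 t.
  move=> [n u] /=; have [[t Pt]|nt] := pselect (exists t', P n u t').
    by exists t.
  by exists t0 => /nt.
(* [H n] records the first [n] terms and is [t0] beyond them; the term of index [n] is read off at
   stage [n.+1]. *)
pose fix H n : nat -> T :=
  if n is m.+1 then fun i => if i == m then sel (m, H m) else H m i
  else fun=> t0.
pose u n := H n.+1 n.
have HE m i : (i < m)%N -> H m i = u i.
  elim: m => // m IH; rewrite ltnS leq_eqVlt => /predU1P[->//|im] /=.
  by rewrite ltn_eqF// IH.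
exists u => n; have [m] := ubnP n; elim: m n => // m IH n nm.
have Pi i : (i < n)%N -> P i (H n) (H n i).
  move=> iltn; rewrite HE//; apply: Ploc (IH i _).
    by move=> j ji; rewrite HE// (ltn_trans ji).
  by rewrite (leq_trans iltn).
rewrite {2}/u /= eqxx; apply: Ploc (selP (n, H n) (Pex _ _ Pi)) => i iltn.
exact: HE.
Qed.

(* The rows f x, x \in X, have only continuous functions in their closure for the
   topology of pointwise convergence on Y -> R. *)
Definition limit_closed (R : realType) (X : Type) (Y : topologicalType)
    (f : X -> Y -> R) : Prop :=
  forall (F : set_system X) (g : Y -> R), ProperFilter F ->
    (forall y, f x y @[x --> F] --> g y) -> continuous g.

Lemma limit_closed_ultra (R : realType) (X : Type) (Y : topologicalType)
    (f : X -> Y -> R) (fb : forall y, exists M : R, forall x, `|f x y| <= M)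
    (I : Type) (F : set_system I) (UF : UltraFilter F) (a : I -> X) :
  limit_closed f ->
  exists2 g : Y -> R, continuous g & forall y, f (a i) y @[i --> F] --> g y.
Proof.
move=> lcf.
have FF : ProperFilter F by exact: ultra_proper.
have /choice[g gP] : forall y, exists l : R, f (a i) y @[i --> F] --> l.
  move=> y; have [M HM] := fb y; exact: ultra_bounded_cvg.
by exists g => //; apply: (lcf (a @ F)).
Qed.

Lemma nat_ultrafilter (S : set nat) :
  (forall N, exists2 n, (N <= n)%N & S n) ->
  exists U : set_system nat,
    [/\ UltraFilter U, forall N, U [set n | (N <= n)%N] & U S].
Proof.
move=> Sinf.
have FF : ProperFilter (within S \oo).
  split; last exact: within_filter.
  by move=> [N _ HN]; have [n Nn /HN] := Sinf N; apply.
have [U [UU FU]] := ultraFilterLemma FF; exists U; split => //.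
  by move=> N; apply: FU; exists N.
by apply: FU; exists 0%N.
Qed.

Lemma tail_ultrafilter : exists2 U : set_system nat, UltraFilter U &
  forall N, U [set n | (N <= n)%N].
Proof.
have [|U [UU tU _]] := @nat_ultrafilter setT; first by move=> N; exists N.
by exists U.
Qed.

Lemma tail_cvg (R : realType) (U : set_system nat) (FU : Filter U)
    (tU : forall N, U [set n | (N <= n)%N]) (d : nat -> R)
    (dlt : forall e, 0 < e -> exists N, forall n, (N <= n)%N -> d n < e)
    (u : nat -> R) (l : R) N :
  (forall n, (N <= n)%N -> `|u n - l| <= d n) -> u @ U --> l.
Proof.
move=> H; apply: dist_cvg => e /dlt[K HK].
apply: filterS (tU (maxn N K)) => n /=; rewrite geq_max => /andP[/H Nn /HK].
exact: le_lt_trans.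
Qed.

(** * Grothendieck's double limit argument *)

Section grothendieck.
Context (R : realType) (X Y : topologicalType).
Hypotheses (crY : completely_regular_space Y) (pX : pseudocompact R X)
  (pY : pseudocompact R Y).
Context (f : X -> Y -> R).
Hypotheses (fX : forall y, continuous (f^~ y)) (fY : forall x, continuous (f x)).

(** A jump of [g] at [x0] yields points [x_n], [y_n] for which the two iterated limits disagree. A
    point [y] attaining the limits along the [y_n] has [f x_k y = g x_k], and the limit row [z]
    satisfies [z y = f x0 y = g x0]. Since [f x_n y] tends to [z y], some [g x_n] comes close to
    [g x0], a contradiction. *)
Lemma limit_closed_swap : limit_closed f -> limit_closed (fun y x => f x y).
Proof.
move=> lcf F g FF Fg x0; apply: dist_cvg => e e0; apply: contrapT => nge.
have [d d0 dlt] := vanishing_seq R.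
have freq (W : set X) : nbhs x0 W -> exists2 x, W x & e <= `|g x - g x0|.
  move=> Wx0; apply: contrapT => H; apply: nge; apply: filterS Wx0 => x Wx /=.
  by rewrite ltNge; apply/negP => le; apply: H; exists x.
have [y0 _] := filter_ex (@filterT _ F _).
(* The clauses make [f x_n] approach [f x0] at each earlier [y_i], keep [g x_n] away from [g x0],
   and make [f x0 y_n] and each [f x_i y_n], [i <= n], approach [g x0] and [g x_i]. *)
pose P n (u : nat -> X * Y) (t : X * Y) :=
  [/\ forall i : 'I_n, `|f t.1 (u i).2 - f x0 (u i).2| < d n,
     e <= `|g t.1 - g x0|, `|f x0 t.2 - g x0| < d n, `|f t.1 t.2 - g t.1| < d n &
     forall i : 'I_n, `|f (u i).1 t.2 - g (u i).1| < d n].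
have [||u uP] := @dependent_choice_seq _ (x0, y0) P.
- by move=> n u v t uv [t1 t2 t3 t4 t5]; split => // i; rewrite -uv.
- move=> n u _.
  have [x Wx ex] : exists2 x,
      forall i : 'I_n, `|f x (u i).2 - f x0 (u i).2| < d n & e <= `|g x - g x0|.
    by apply: freq; apply: filter_forall => i; exact: continuous_dist.
  have [y [[y1 y2] y3]] : exists y, (`|f x0 y - g x0| < d n /\
      `|f x y - g x| < d n) /\ forall i : 'I_n, `|f (u i).1 y - g (u i).1| < d n.
    apply: (@filter_ex _ F); apply: filterI; last first.
      by apply: filter_forall => i; exact: cvg_dist (Fg _) _ _.
    by apply: filterI; exact: cvg_dist (Fg _) _ _.
  by exists (x, y).
have [U UU tU] := tail_ultrafilter.
have FU : ProperFilter U by exact: ultra_proper.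
have [z zc zP] := limit_closed_ultra (fun y => pX (@fX y)) UU (fun n => (u n).1) lcf.
(* Index 0 is the limit row [z], index 1 the row of [x0], and index [n.+2] the row of the n-th
   point. *)
pose h k := if k is k'.+1 then if k' is n.+1 then f (u n).1 else f x0 else z.
have hc k : continuous (h k) by case: k => [|[|n]]; [exact: zc|exact: fY|exact: fY].
have [y yP] := pseudocompact_ultra_limit crY pY UU (fun n => (u n).2) hc.
have uy k : f (u k).1 y = g (u k).1.
  apply: cvg_to_eq (yP k.+2) _.
  apply: (@tail_cvg _ U _ tU d dlt _ _ k) => n.
  rewrite leq_eqVlt => /predU1P[<-|kn]; first by case: (uP k) => _ _ _ /ltW.
  by have [_ _ _ _ /(_ (Ordinal kn))/ltW] := uP n.
have x0y : f x0 y = g x0.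
  apply: cvg_to_eq (yP 1%N) _; apply: (@tail_cvg _ U _ tU d dlt _ _ 0) => n _.
  by have [_ _ /ltW] := uP n.
have zu i : z (u i).2 = f x0 (u i).2.
  apply: cvg_to_eq (zP _) _; apply: (@tail_cvg _ U _ tU d dlt _ _ i.+1) => n iltn.
  by have [/(_ (Ordinal iltn))/ltW] := uP n.
have zy : z y = g x0.
  rewrite -x0y; apply: cvg_to_eq (yP 0%N) _ => /=.
  by under eq_cvg do rewrite zu; exact: (yP 1%N).
have := zP y; rewrite zy => /(cvg_dist _)/(_ _ e0) /filter_ex[n /=].
by rewrite uy ltNge; case: (uP n) => _ ->.
Qed.

End grothendieck.

(** * Finite nets and the Baire property *)

Lemma filter_seq (T : choiceType) (X : Type) (F : set_system X) (FF : Filter F)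
    (P : T -> set X) (s : seq T) :
  (forall t, t \in s -> F (P t)) -> F [set x | forall t, t \in s -> P t x].
Proof.
elim: s => [_|t s IH H]; first by apply: filterE.
apply: filterS2 (H t (mem_head _ _)) (IH _) => [x Pt Ps t'|t' ts].
  by rewrite in_cons => /predU1P[->//|]; exact: Ps.
by apply: H; rewrite in_cons ts orbT.
Qed.

(** The range of each [h i] is cut into finitely many cells of length [e]; [col y] records the cells
    of [y], and one representative per value of [col] makes the net. *)
Lemma finite_net (R : realType) (Y : choiceType) (n : nat) (h : 'I_n -> Y -> R)
    (e : R) :
  0 < e -> (forall i, exists M : R, forall y, `|h i y| <= M) ->
  exists s : seq Y, forall y, exists2 t, t \in s & forall i, `|h i y - h i t| <= e.
Proof.
move=> e0 /choice[M hM].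
have [[y0 _]|Y0] := pselect (exists y0 : Y, True); last first.
  by exists [::] => y; exfalso; apply: Y0; exists y.
pose c i y := Num.truncn ((h i y + M i) / e).
have hM0 i y : 0 <= (h i y + M i) / e.
  by rewrite divr_ge0 ?(ltW e0)// -lerBlDr sub0r; have := hM i y; rewrite ler_norml => /andP[].
pose N := (\max_(i < n) Num.truncn (2 * M i / e))%N.
have cN i y : (c i y < N.+1)%N.
  rewrite ltnS; apply: (@leq_trans (Num.truncn (2 * M i / e))).
    apply: le_truncn; rewrite ler_pM2r ?invr_gt0// mulr2n mulrDl !mul1r lerD2r.
    by have := hM i y; rewrite ler_norml => /andP[].
  exact: (@leq_bigmax _ (fun i => Num.truncn (2 * M i / e))).
pose col y : {ffun 'I_n -> 'I_N.+1} := [ffun i => inord (c i y)].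
(* [y0] is a default for the cell patterns that no point realizes. *)
pose rep k := xget y0 [set y | col y = k].
exists [seq rep k | k <- enum {: {ffun 'I_n -> 'I_N.+1}}] => y.
exists (rep (col y)); first by apply: map_f; rewrite mem_enum.
move=> i; rewrite /rep; case: xgetP => [t _ /= |/(_ y) /= /(_ erefl)[]].
move=> /ffunP/(_ i); rewrite !ffunE => /(congr1 val) /=.
rewrite !inordK// => ct.
have /truncn_itv := hM0 i y; have /truncn_itv := hM0 i t.
rewrite -/(c i t) -/(c i y) ct ler_pdivlMr// ltr_pdivrMr// ler_pdivlMr// ltr_pdivrMr//.
rewrite -natr1 => /andP[t1 t2] /andP[y1 y2]; rewrite ler_norml; nra.
Qed.

(** Regularity gives nested open sets with closures in the [O n]. Since they decrease, a cluster
    point lies in every closure; it replaces the point that compactness would give. *)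
Lemma pseudocompact_baire (R : realType) (X : topologicalType)
    (crX : completely_regular_space X) (pX : pseudocompact R X)
    (O : nat -> set X) :
  (forall n, open (O n)) -> (forall n, dense (O n)) -> dense (\bigcap_n O n).
Proof.
move=> oO dO W [x0 Wx0] oW.
pose P n (u : nat -> X * set X) (t : X * set X) :=
  [/\ open t.2, t.2 t.1, closure t.2 `<=` O n `&` W &
    forall i : 'I_n, t.2 `<=` (u i).2].
have [||u uP] := @dependent_choice_seq _ (x0, W) P.
- by move=> n u v t uv [t1 t2 t3 t4]; split => // i; rewrite -uv.
- move=> n u uP.
  have [B [oB [b Bb] BW Bu]] : exists B : set X,
      [/\ open B, B !=set0, B `<=` W & forall i : 'I_n, B `<=` (u i).2].
    case: n uP => [|n] uP; first by exists W; split => //; [exists x0|case].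
    have [t1 t2 t3 t4] := uP n (ltnSn n); exists (u n).2; split => //.
    + by exists (u n).1.
    + by move=> x /subset_closure /t3[].
    + move=> [i /=]; rewrite ltnS leq_eqVlt => /predU1P[->//|ilt].
      exact: (t4 (Ordinal ilt)).
  have [x [Bx Ox]] := dO n B (ex_intro _ b Bb) oB.
  have nx : nbhs x (B `&` O n) by apply: open_nbhs_nbhs; split=> //; exact: openI.
  have [V Vx VB] := completely_regular_regular (R := R) crX nx.
  exists (x, V^°); split => /=.
  + exact: open_interior.
  + exact: Vx.
  + move=> z /(closure_subset (@interior_subset _ V)) /VB[Bz Oz]; split => //.
    exact: BW.
  + by move=> i z /interior_subset /subset_closure /VB[/Bu].
have uanti n m : (n <= m)%N -> (u m).2 `<=` (u n).2.
  rewrite leq_eqVlt => /predU1P[->//|nm].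
  by have [_ _ _ /(_ (Ordinal nm))] := uP m.
have unb n : nbhs (u n).1 (u n).2 by apply: open_nbhs_nbhs; have [] := uP n.
have [z zP] := pseudocompact_cluster crX pX unb.
have zcl n : closure (u n).2 z.
  by move=> N /zP/(_ n)[m nm [t [/(uanti _ _ nm) ? ?]]]; exists t.
exists z; split; first by have [_ _ /(_ _ (zcl 0%N))[]] := uP 0%N.
by move=> n _; have [_ _ /(_ _ (zcl n))[]] := uP n.
Qed.

(** * Namioka's theorem on points of uniform continuity *)

Section namioka.
Context (R : realType) (X Y : topologicalType).
Hypotheses (crX : completely_regular_space X) (crY : completely_regular_space Y)
  (pX : pseudocompact R X) (pY : pseudocompact R Y).
Context (f : X -> Y -> R).
Hypotheses (fX : forall y, continuous (f^~ y)) (fY : forall x, continuous (f x)).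
Hypothesis lcf : limit_closed f.

(** Otherwise one finds points [x_n] in shrinking open sets [V_n] and pairs [y_n], [y'_n] that
    almost agree for the earlier rows but differ by more than [e / 4] for all rows from [V_n]. A
    limit row [g] of the [f x_n] then separates two points [y], [y'] that no [f x_n] separates. *)
Lemma small_uniform_oscillation (V0 : set X) (e : R) :
  open V0 -> V0 !=set0 -> 0 < e ->
  exists V : set X, [/\ open V, V !=set0, V `<=` V0 &
    forall x x' y, V x -> V x' -> `|f x y - f x' y| <= e].
Proof.
move=> oV0 [x0 Vx0] e0; apply: contrapT => noV.
have [[y0 _]|Y0] := pselect (exists y0 : Y, True); last first.
  by apply: noV; exists V0; split => //; [exists x0|move=> x x' y; case: Y0; exists y].
have [d d0 dlt] := vanishing_seq R.
pose T : Type := (X * set X * (Y * Y))%type.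
pose P n (u : nat -> T) (t : T) :=
  [/\ open t.1.2 /\ t.1.2 t.1.1, t.1.2 `<=` V0,
    forall i : 'I_n, t.1.2 `<=` (u i).1.2,
    forall i : 'I_n, `|f (u i).1.1 t.2.1 - f (u i).1.1 t.2.2| <= d n &
    forall x, t.1.2 x -> e / 4 < `|f x t.2.1 - f x t.2.2|].
have [||u uP] := @dependent_choice_seq _ ((x0, V0, (y0, y0)) : T) P.
- by move=> n u v t uv [t1 t2 t3 t4 t5]; split => // i; rewrite -uv.
- move=> n u uP.
  have [B [oB [b Bb] BW Bu]] : exists B : set X,
      [/\ open B, B !=set0, B `<=` V0 & forall i : 'I_n, B `<=` (u i).1.2].
    case: n uP => [|n] uP; first by exists V0; split => //; [exists x0|case].
    have [[t1 t2] t3 t4 _ _] := uP n (ltnSn n); exists (u n).1.2; split => //.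
    + by exists (u n).1.1.
    + move=> [i /=]; rewrite ltnS leq_eqVlt => /predU1P[->//|ilt].
      exact: (t4 (Ordinal ilt)).
  (* Otherwise each row from [B] varies by at most [e / 4] between a point and its net point, and
     near [b] it is within [e / 8] of the row of [b] on the net: the oscillation near [b] would be
     at most [3 e / 4]. *)
  have [x [y [y' [Bx fy fx]]]] : exists x y y', [/\ B x,
      forall i : 'I_n, `|f (u i).1.1 y - f (u i).1.1 y'| <= d n &
      e / 4 < `|f x y - f x y'|].
    apply: contrapT => H.
    have [s sP] := finite_net (d0 n) (fun i : 'I_n => pY (@fY (u i).1.1)).
    have := open_nbhs_nbhs (conj oB Bb).
    have e80 : 0 < e / 8 by rewrite divr_gt0.
    have := filter_seq (nbhs_filter b) (s := s)
      (fun t _ => continuous_dist (@fX t) b e80).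
    move=> /filterI/[apply]; rewrite nbhsE => -[V [oV Vb VP]].
    apply: noV; exists V; split => //; first by exists b.
      by move=> z /VP[_ /BW].
    move=> z z' y Vz Vz'; have [t ts tP] := sP y.
    have [/= /(_ t ts) z1 Bz] := VP _ Vz; have [/= /(_ t ts) z'1 Bz'] := VP _ Vz'.
    have z2 : `|f z y - f z t| <= e / 4.
      by rewrite leNgt; apply/negP => ltzy; apply: H; exists z, y, t.
    have z'2 : `|f z' y - f z' t| <= e / 4.
      by rewrite leNgt; apply/negP => ltzy; apply: H; exists z', y, t.
    have := ler_distD (f z t) (f z y) (f z' y).
    have := ler_distD (f z' t) (f z t) (f z' y).
    have := ler_distD (f b t) (f z t) (f z' t).
    rewrite (distrC (f b t)) (distrC (f z' t) (f z' y)); lra.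
  have : nbhs x (B `&` [set x | e / 4 < `|f x y - f x y'|]).
    apply: filterI; first exact: open_nbhs_nbhs.
    have e1 : 0 < (`|f x y - f x y'| - e / 4) / 2 by rewrite divr_gt0 ?subr_gt0.
    apply: filterS2 (continuous_dist (@fX y) x e1)
      (continuous_dist (@fX y') x e1) => z /= h1 h2.
    have := ler_distD (f z y) (f x y) (f x y').
    have := ler_distD (f z y') (f z y) (f x y').
    rewrite (distrC (f x y) (f z y)); lra.
  rewrite nbhsE => -[V [oV Vx VP]].
  exists (x, V, (y, y')); split => //=.
  + by move=> z /VP[/BW].
  + by move=> i z /VP[/Bu].
  + by move=> z /VP[].
have [U UU tU] := tail_ultrafilter.
have FU : ProperFilter U by exact: ultra_proper.
have [g gc gP] := limit_closed_ultra (fun y => pX (@fX y)) UU (fun n => (u n).1.1) lcf.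
pose h k := if k is n.+1 then f (u n).1.1 else g.
have hc k : continuous (h k) by case: k => [|n]; [exact: gc|exact: fY].
have [y yP] := pseudocompact_ultra_limit crY pY UU (fun n => (u n).2.1) hc.
have [y' y'P] := pseudocompact_ultra_limit crY pY UU (fun n => (u n).2.2) hc.
have fyy' k : f (u k).1.1 y = f (u k).1.1 y'.
  apply/eqP; rewrite -subr_eq0; apply/eqP.
  apply: cvg_to_eq (cvgB (yP k.+1) (y'P k.+1)) _.
  apply: (@tail_cvg _ U _ tU d dlt _ _ k.+1) => n kn; rewrite subr0.
  by have [_ _ _ /(_ (Ordinal kn))] := uP n.
have gyy' : g y = g y'.
  by apply: cvg_to_eq (gP y) _; under eq_cvg do rewrite fyy'; exact: gP.
(* For [m >= n] the point [x_m] lies in [V_n], so the separation persists in the limit row. *)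
have gn n : e / 4 <= `|g (u n).2.1 - g (u n).2.2|.
  apply: (cvgr_to_ge (cvg_norm (cvgB (gP _) (gP _)))).
  apply: filterS (tU n) => m; rewrite /= leq_eqVlt => /predU1P[<-|nm].
    by have [[_ t2] _ _ _ t5] := uP n; rewrite ltW// t5.
  have [_ _ _ _ t5] := uP n; rewrite ltW// t5//.
  by have [[_ t2] _ /(_ (Ordinal nm)) /= t4 _ _] := uP m; exact: t4.
have : e / 4 <= `|g y - g y'|.
  exact: (cvgr_to_ge (cvg_norm (cvgB (yP 0%N) (y'P 0%N))) (filterE _ gn)).
by rewrite gyy' subrr normr0; lra.
Qed.

(** [O n] is the union of the open sets of oscillation at most [d n]. It is dense by
    [small_uniform_oscillation], so the Baire property applies. *)
Lemma uniform_continuity_points :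
  exists E : set X, [/\ dense E, Gdelta E & forall x (e : R), E x -> 0 < e ->
    nbhs x [set x' | forall y, `|f x' y - f x y| <= e]].
Proof.
have [d d0 dlt] := vanishing_seq R.
pose O n := \bigcup_(V in [set V : set X | open V /\
  forall x x' y, V x -> V x' -> `|f x y - f x' y| <= d n]) V.
have oO n : open (O n) by apply: bigcup_open => V [].
exists (\bigcap_n O n); split.
- apply: (pseudocompact_baire crX pX oO) => n W W0 oW.
  have [V [oV [x Vx] VW VP]] := small_uniform_oscillation oW W0 (d0 n).
  by exists x; split; [exact: VW|exists V].
- by exists O.
- move=> x e Ex /dlt[n /(_ n (leqnn _))/ltW ne].
  have [V [oV VP] Vx] := Ex n I.
  apply: filterS (open_nbhs_nbhs (conj oV Vx)) => x' Vx' y.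
  exact: le_trans (VP _ _ y Vx' Vx) ne.
Qed.

End namioka.

(** * Sequences of rows converging to a limit of rows *)

Section sequential_approximation.
Context (R : realType) (X Y : topologicalType).
Hypotheses (crX : completely_regular_space X) (crY : completely_regular_space Y)
  (pX : pseudocompact R X) (pY : pseudocompact R Y).
Context (f : X -> Y -> R).
Hypotheses (fX : forall y, continuous (f^~ y)) (fY : forall x, continuous (f x)).
Hypothesis lcf : limit_closed f.

(** Stage [n] fixes a finite net for [g] and the earlier rows up to [d n], then a row close to [g]
    on all nets so far. If convergence fails at [y], net points [t n] imitating [y] lead to a point
    [w] that neither the chosen rows nor [g] distinguish from [y]; a limit row [z] equals [g] at
    every [t n], hence at [w] and at [y]. *)
Lemma sequential_approximation (S : set X) (g : Y -> R) : continuous g ->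
  (forall (s : seq Y) (e : R), 0 < e ->
     exists2 x, S x & forall y, y \in s -> `|f x y - g y| < e) ->
  exists2 a : nat -> X, forall n, S (a n) &
    forall y, f (a n) y @[n --> \oo] --> g y.
Proof.
move=> gc gS.
have [d d0 dlt] := vanishing_seq R.
have [x0 Sx0 _] := gS [::] 1 ltr01.
pose T : Type := (X * seq Y)%type.
pose P n (u : nat -> T) (t : T) :=
  [/\ S t.1, forall y, exists2 z, z \in t.2 &
      (forall i : 'I_n, `|f (u i).1 y - f (u i).1 z| <= d n) /\
      `|g y - g z| <= d n,
    forall i : 'I_n, forall y, y \in (u i).2 -> `|f t.1 y - g y| < d n &
    forall y, y \in t.2 -> `|f t.1 y - g y| < d n].
have [||u uP] := @dependent_choice_seq _ ((x0, [::]) : T) P.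
- move=> n u v t uv [t1 t2 t3 t4]; split => //.
  + move=> y; have [z zt [z1 z2]] := t2 y; exists z => //; split => // i.
    by rewrite -uv.
  + by move=> i y; rewrite -uv//; exact: t3.
- move=> n u uP.
  (* The net must control the [n] earlier rows and [g]; [g] takes the last index. *)
  pose h (i : 'I_n.+1) := if (i < n)%N then f (u i).1 else g.
  have hb i : exists M : R, forall y, `|h i y| <= M.
    by rewrite /h; case: ifP => _; [exact: pY (@fY _)|exact: pY gc].
  have [s sP] := finite_net (d0 n) hb.
  have [x Sx xP] := gS (s ++ flatten [seq (u i).2 | i <- iota 0 n]) _ (d0 n).
  exists (x, s); split => //=.
  + move=> y; have [z zs zP] := sP y; exists z => //; split => [i|].
      by have := zP (widen_ord (leqnSn n) i); rewrite /h /= ltn_ord.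
    by have := zP ord_max; rewrite /h /= ltnn.
  + move=> i y yi; apply: xP; rewrite mem_cat; apply/orP; right.
    by apply/flatten_mapP; exists (nat_of_ord i) => //; rewrite mem_iota ltn_ord.
  + by move=> y ys; apply: xP; rewrite mem_cat ys.
exists (fun n => (u n).1); first by move=> n; case: (uP n).
move=> y; apply: dist_cvg => e e0; apply: contrapT => nN.
(* [U] contains the set of indices where the row stays [e] away from [g y], so [z y = g y] will be
   contradictory. *)
have [|U [UU tU SU]] := @nat_ultrafilter [set n | e <= `|f (u n).1 y - g y|].
  move=> N; apply: contrapT => H; apply: nN; exists N => // n Nn /=.
  by rewrite ltNge; apply/negP => le; apply: H; exists n.
have FU : ProperFilter U by exact: ultra_proper.
have [z zc zP] := limit_closed_ultra (fun y => pX (@fX y)) UU (fun n => (u n).1) lcf.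
have /choice[t tP] : forall n, exists t : Y, t \in (u n).2 /\
    (forall i : 'I_n, `|f (u i).1 y - f (u i).1 t| <= d n) /\ `|g y - g t| <= d n.
  by move=> n; have [_ /(_ y)[t ? ?] _ _] := uP n; exists t.
pose h k := if k is k'.+1 then if k' is n.+1 then f (u n).1 else g else z.
have hc k : continuous (h k) by case: k => [|[|n]]; [exact: zc|exact: gc|exact: fY].
have [w wP] := pseudocompact_ultra_limit crY pY UU t hc.
have fw k : f (u k).1 w = f (u k).1 y.
  apply: cvg_to_eq (wP k.+2) _; apply: (@tail_cvg _ U _ tU d dlt _ _ k.+1) => n kn.
  by have [_ [/(_ (Ordinal kn)) + _]] := tP n; rewrite distrC.
have gw : g w = g y.
  apply: cvg_to_eq (wP 1%N) _; apply: (@tail_cvg _ U _ tU d dlt _ _ 0) => n _.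
  by have [_ [_ +]] := tP n; rewrite distrC.
have zt n : z (t n) = g (t n).
  apply: cvg_to_eq (zP _) _; apply: (@tail_cvg _ U _ tU d dlt _ _ n) => m.
  have [tn _] := tP n.
  rewrite leq_eqVlt => /predU1P[<-|nm]; first by case: (uP n) => _ _ _ /(_ _ tn)/ltW.
  by have [_ _ /(_ (Ordinal nm) _ tn)/ltW] := uP m.
have zw : z w = g w.
  apply: cvg_to_eq (wP 0%N) _ => /=.
  by under eq_cvg do rewrite zt; exact: (wP 1%N).
have zy : z w = z y.
  by apply: cvg_to_eq (zP w) _; under eq_cvg do rewrite fw; exact: zP.
have zg : z y = g y by rewrite -zy zw gw.
have := cvg_dist FU (zP y) e0; rewrite zg => /(filterI SU)/filter_ex[n [/=]].
by rewrite leNgt => /negbTE->.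
Qed.

Lemma limit_attained (F : set_system X) (g : Y -> R) : ProperFilter F ->
  (forall y, f x y @[x --> F] --> g y) -> exists x, forall y, f x y = g y.
Proof.
move=> FF Fg; have gc := lcf FF Fg.
have [E [dE _ EP]] := uniform_continuity_points crX crY pX pY fX fY lcf.
(* A point whose row is close to [g] on the finite set [s] can be moved into the dense set [E], the
   functions [f^~ y] being continuous. *)
have [|a Ea aP] := @sequential_approximation E g gc.
  move=> s e e0.
  have e20 : 0 < e / 2 by rewrite divr_gt0.
  have := filter_seq FF (s := s) (fun y _ => cvg_dist FF (Fg y) e20).
  move=> /filter_ex[x xP].
  have := filter_seq (nbhs_filter x) (s := s)
    (fun y _ => continuous_dist (@fX y) x e20).
  rewrite nbhsE => -[V [oV Vx VP]].
  have [x' [/VP Vx' Ex']] := dE V (ex_intro _ x Vx) oV.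
  exists x' => // y ys; have /= h1 := xP _ ys; have /= h2 := Vx' _ ys.
  have := ler_distD (f x y) (f x' y) (g y); lra.
have [d d0 dlt] := vanishing_seq R.
(* The neighborhoods control the rows uniformly in [y], so a single [x] serves all [y]. *)
have [x xP] := pseudocompact_cluster crX pX (fun n => EP _ _ (Ea n) (d0 n)).
exists x => y; apply: dist_eps_eq => e e0.
have e30 : 0 < e / 3 by rewrite divr_gt0.
have [N HN] := dlt _ e30; have [M _ HM] := cvg_dist eventually_filter (aP y) e30.
have [n] := xP _ (continuous_dist (@fX y) x e30) (maxn N M).
rewrite geq_max => /andP[/HN dn /HM /= an] [x' [/(_ y) ax' /= xx']].
have := ler_distD (f x' y) (f x y) (g y).
have := ler_distD (f (a n) y) (f x' y) (g y).
rewrite (distrC (f x y) (f x' y)); lra.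
Qed.

End sequential_approximation.

(** * Quasi-continuous functions *)

(** Stated with boxes for a curried function, so that exchanging the variables and changing the sign
    are immediate. *)
Definition quasi_continuous2 (R : realType) (X Y : topologicalType)
    (f : X -> Y -> R) : Prop :=
  forall x y (U : set X) (V : set Y) (e : R), nbhs x U -> nbhs y V -> 0 < e ->
    exists (U' : set X) (V' : set Y), [/\ open U' /\ U' !=set0,
      open V' /\ V' !=set0, U' `<=` U, V' `<=` V &
      forall x' y', U' x' -> V' y' -> `|f x' y' - f x y| < e].

Lemma quasi_continuous2_swap (R : realType) (X Y : topologicalType)
    (f : X -> Y -> R) :
  quasi_continuous2 f -> quasi_continuous2 (fun y x => f x y).
Proof.
move=> qf y x V U e yV xU e0; have [U' [V' [U1 V1 U2 V2 H]]] := qf _ _ _ _ _ xU yV e0.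
by exists V', U'; split => // y' x' Vy' Ux'; exact: H.
Qed.

Lemma quasi_continuous2N (R : realType) (X Y : topologicalType)
    (f : X -> Y -> R) :
  quasi_continuous2 f -> quasi_continuous2 (fun x y => - f x y).
Proof.
move=> qf x y U V e xU yV e0; have [U' [V' [U1 V1 U2 V2 H]]] := qf _ _ _ _ _ xU yV e0.
by exists U', V'; split => // x' y' Ux' Vy'; rewrite -opprD normrN; exact: H.
Qed.

Lemma cluster_le (R : realType) (X : topologicalType) (U : nat -> set X) (z : X)
    (phi : X -> R) (c : R) (N : nat) : continuous phi ->
  (forall W : set X, nbhs z W -> forall N, exists2 n, (N <= n)%N & U n `&` W !=set0) ->
  (forall n x, (N <= n)%N -> U n x -> phi x <= c) -> phi z <= c.
Proof.
move=> pc zP UP; rewrite leNgt; apply/negP => cz.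
have e0 : 0 < phi z - c by rewrite subr_gt0.
have [n Nn [x [Ux /=]]] := zP _ (continuous_dist pc z e0) N.
have := UP n x Nn Ux => le; rewrite ltr_norml => /andP[]; lra.
Qed.

Lemma continuousN_fun (R : realType) (X : topologicalType) (f : X -> R) :
  continuous f -> continuous (fun x => - f x).
Proof. by move=> fc x; apply: cvgN; exact: fc. Qed.

(* If the conclusion fails, one finds y_n in decreasing open sets (the sets where
   the bump functions are > 1/2) with g(y_n) < a, and open U_n with f <= a on
   U_n x {y_i} for i <= n but f >= b on U_n times the n-th open set. *)
Lemma quasi_box_le (R : realType) (X Y : topologicalType)
    (crX : completely_regular_space X) (crY : completely_regular_space Y)
    (pX : pseudocompact R X) (pY : pseudocompact R Y) (f : X -> Y -> R)
    (fX : forall y, continuous (f^~ y)) (fY : forall x, continuous (f x))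
    (qf : quasi_continuous2 f) (F : set_system X) (FF : ProperFilter F)
    (g : Y -> R) (Fg : forall y, f x y @[x --> F] --> g y)
    (V : set Y) (a b : R) :
  open V -> V !=set0 -> a < b ->
  (forall V', open V' -> V' !=set0 -> V' `<=` V -> exists2 y, V' y & g y < a) ->
  exists (V' : set Y) (P : set X), [/\ open V' /\ V' !=set0, V' `<=` V,
    open P /\ F P & forall x y, P x -> V' y -> f x y <= b].
Proof.
move=> oV [v0 Vv0] ab gd; apply: contrapT => noV.
have [x0 _] := filter_ex (@filterT _ F _).
pose T : Type := (Y * (X * set X) * (Y * (Y -> R)))%type.
pose pt (t : T) := t.1.1. pose px (t : T) := t.1.2.1. pose pU (t : T) := t.1.2.2.
pose pv (t : T) := t.2.1. pose pp (t : T) := t.2.2.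
pose P n (u : nat -> T) (t : T) :=
  [/\ (forall i : 'I_n, 1 / 2 < pp (u i) (pt t)) /\ g (pt t) < a,
     (nbhs (px t) (pU t) /\ forall x, pU t x -> f x (pt t) <= a),
     forall (i : 'I_n) x, pU t x -> f x (pt (u i)) <= a,
     continuous (pp t) /\ 1 / 2 < pp t (pv t) &
     forall y, pp t y != 0 -> [/\ V y, forall x, pU t x -> b <= f x y &
       forall i : 'I_n, 1 / 2 < pp (u i) y]].
have [||u uP] := @dependent_choice_seq _ ((v0, (x0, setT), (v0, cst 0)) : T) P.
- move=> n u v t uv [[t1 t1'] t2 t3 t4 t5]; split => //.
  + by split => // i; rewrite -uv.
  + by move=> i; rewrite -uv//; exact: t3.
  + by move=> y /t5[? ? t6]; split => // i; rewrite -uv.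
- move=> n u uP.
  have [B [oB [w Bw] BV Bu]] : exists B : set Y,
      [/\ open B, B !=set0, B `<=` V & forall (i : 'I_n) y, B y -> 1 / 2 < pp (u i) y].
    case: n uP => [|n] uP; first by exists V; split => //; [exists v0|case].
    have [_ _ _ [t1 t1'] t2] := uP n (ltnSn n).
    have ne0 y : 1 / 2 < pp (u n) y -> pp (u n) y != 0.
      by move=> h; apply: lt0r_neq0; lra.
    exists [set y | 1 / 2 < pp (u n) y]; split => //.
    + apply: (@open_comp _ _ (pp (u n)) [set r | 1 / 2 < r]); last exact: open_gt.
      by move=> y _; exact: t1.
    + by exists (pv (u n)).
    + by move=> y /ne0 /t2[].
    + move=> [i /=]; rewrite ltnS leq_eqVlt => /predU1P[->//|ilt] y.
      by move=> /ne0 /t2[_ _ /(_ (Ordinal ilt))].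
  have [y By ga] := gd B oB (ex_intro _ w Bw) BV.
  pose Q : set X := [set x | (forall i : 'I_n, f x (pt (u i)) < a) /\ f x y < a].
  have nlt (z : Y) x : f x z < a -> nbhs x [set x | f x z < a].
    move=> h; have e0 : 0 < a - f x z by rewrite subr_gt0.
    apply: filterS (continuous_dist (@fX z) x e0) => x' /=.
    by rewrite ltr_norml => /andP[]; lra.
  have Flt (z : Y) : g z < a -> F [set x | f x z < a].
    move=> h; have e0 : 0 < a - g z by rewrite subr_gt0.
    apply: filterS (cvg_dist FF (Fg z) e0) => x' /=.
    by rewrite ltr_norml => /andP[]; lra.
  have oQ : open Q.
    rewrite openE => x [Q1 Q2]; apply: filterI; last exact: nlt.
    by apply: filter_forall => i; exact: nlt.
  have FQ : F Q.
    apply: filterI; last exact: Flt.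
    by apply: filter_forall => i; apply: Flt; have [[]] := uP i (ltn_ord i).
  have [x [y' [Qx By' bf]]] : exists x y', [/\ Q x, B y' & b < f x y'].
    apply: contrapT => H; apply: noV; exists B, Q; split => //.
      by split => //; exists w.
    move=> x y' Qx By'; rewrite leNgt; apply/negP => lt.
    by apply: H; exists x, y'.
  have e0 : 0 < f x y' - b by rewrite subr_gt0.
  have [U' [V' [[oU' [x' Ux']] [oV' [v Vv]] UQ VB fUV]]] := qf _ _ _ _ _
    (open_nbhs_nbhs (conj oQ Qx)) (open_nbhs_nbhs (conj oB By')) e0.
  have [p [pc p01 pv1 pV]] := completely_regular_bump R crY
    (open_nbhs_nbhs (conj oV' Vv)).
  exists ((y, (x', U')), (v, p)); split => /=.
  + by split => // i; exact: Bu.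
  + by split; [exact: open_nbhs_nbhs|move=> z /UQ[_ /ltW]].
  + by move=> i z /UQ[/(_ i)/ltW].
  + by rewrite /pp /pv /= pv1; split => //; lra.
  + move=> z pz; have Vz : V' z by apply: contrapT => /pV; apply/eqP.
    split; [exact/BV/VB| |by move=> i; exact/Bu/VB].
    by move=> z' Uz'; have := fUV _ _ Uz' Vz; rewrite ltr_norml => /andP[]; lra.
have unb n : nbhs (px (u n)) (pU (u n)) by have [_ []] := uP n.
have [x xP] := pseudocompact_cluster crX pX unb.
have [U UU tU] := tail_ultrafilter.
have FU : ProperFilter U by exact: ultra_proper.
pose h k := if k is n.+1 then pp (u n) else f x.
have hc k : continuous (h k).
  by case: k => [|n]; [exact: fY|have [_ _ _ []] := uP n].
have [y yP] := pseudocompact_ultra_limit crY pY UU (fun n => pt (u n)) hc.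
have fxi i : f x (pt (u i)) <= a.
  apply: (@cluster_le _ _ _ x (f^~ (pt (u i))) a i (@fX _) xP) => n x' /=.
  rewrite leq_eqVlt => /predU1P[<-|ilt]; first by have [_ [_ +] _ _ _] := uP i; apply.
  by have [_ _ /(_ (Ordinal ilt)) + _ _] := uP n; apply.
have fxy : f x y <= a.
  by apply: (cvgr_to_le (yP 0%N)); apply: filterE => i; exact: fxi.
(* The strict bound [1 / 2 <] becomes [1 / 2 <=] in the limit and still excludes 0, so the last
   clause of [P] applies to [y] for every [k]. *)
have pky k : pp (u k) y != 0.
  apply/lt0r_neq0/(@lt_le_trans _ _ (1 / 2)) => //.
  apply: (cvgr_to_ge (yP k.+1)); apply: filterS (tU k.+1) => n /= kn.
  by have [[/(_ (Ordinal kn)) /ltW]] := uP n.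
have : - f x y <= - b.
  apply: (@cluster_le _ _ _ x (fun x => - f x y) (- b) 0%N _ xP).
    by apply: continuousN_fun; exact: fX.
  move=> n x' _ Ux'; rewrite lerN2.
  by have [_ _ _ _ /(_ _ (pky n))[_ + _]] := uP n; apply.
lra.
Qed.

Section quasi_limit.
Context (R : realType) (X Y : topologicalType).
Hypotheses (crX : completely_regular_space X) (crY : completely_regular_space Y)
  (pX : pseudocompact R X) (pY : pseudocompact R Y).

(** Besides [U_n] and [V_n], the construction carries neighborhoods [W_n] of [y0], in which the
    later [V_m] are taken, and open members [P_n] of [F], in which the later [U_m] are taken. The
    level [c] between [a] and [b] is what remains of the lower bound after [quasi_box_le]. *)
Lemma quasi_no_jump (f : X -> Y -> R)
    (fX : forall y, continuous (f^~ y)) (fY : forall x, continuous (f x))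
    (qf : quasi_continuous2 f) (F : set_system X) (FF : ProperFilter F)
    (g : Y -> R) (Fg : forall y, f x y @[x --> F] --> g y) (y0 : Y) (a b : R) :
  a < b -> b < g y0 ->
  ~ (forall V : set Y, nbhs y0 V -> exists (V' : set Y) (P : set X),
    [/\ open V' /\ V' !=set0, V' `<=` V, open P /\ F P &
        forall x y, P x -> V' y -> f x y <= a]).
Proof.
move=> ab bg H.
have [x0 _] := filter_ex (@filterT _ F _).
pose T : Type := (X * set X * set Y * (Y * set Y * set X))%type.
pose px (t : T) := t.1.1.1. pose pU (t : T) := t.1.1.2. pose pW (t : T) := t.1.2.
pose pv (t : T) := t.2.1.1. pose pV (t : T) := t.2.1.2. pose pP (t : T) := t.2.2.
pose c := (a + b) / 2.
pose P n (u : nat -> T) (t : T) :=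
  [/\ nbhs (px t) (pU t) /\ forall i : 'I_n, pU t `<=` pP (u i),
    nbhs (pv t) (pV t) /\ forall i : 'I_n, pV t `<=` pW (u i),
    nbhs y0 (pW t) /\ pV t `<=` pW t,
    forall x y, pU t x -> pW t y -> c <= f x y &
    (open (pP t) /\ F (pP t)) /\ forall x y, pP t x -> pV t y -> f x y <= a].
have [||u uP] :=
    @dependent_choice_seq _ ((x0, setT, setT, (y0, setT, setT)) : T) P.
- move=> n u v t uv [[t1 t1'] [t2 t2'] t3 t4 t5]; split => //; split => // i;
    by rewrite -uv.
- move=> n u uP.
  pose B := [set x | (forall i : 'I_n, pP (u i) x) /\ b < f x y0].
  have oB : open B.
    rewrite openE => x [B1 B2]; apply: filterI.
      apply: filter_forall => i; apply: open_nbhs_nbhs; split => //.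
      by have [_ _ _ _ [[]]] := uP i (ltn_ord i).
    have e0 : 0 < f x y0 - b by rewrite subr_gt0.
    apply: filterS (continuous_dist (@fX y0) x e0) => x' /=.
    by rewrite ltr_norml => /andP[]; lra.
  have : F B.
    apply: filterI.
      by apply: filter_forall => i; have [_ _ _ _ [[]]] := uP i (ltn_ord i).
    have e0 : 0 < g y0 - b by rewrite subr_gt0.
    apply: filterS (cvg_dist FF (Fg y0) e0) => x' /=.
    by rewrite ltr_norml => /andP[]; lra.
  move=> /filter_ex B0.
  (* Here [quasi_box_le] is used with the variables exchanged, the sign changed and the filter
     [nbhs y0]: it gives [U] inside [B] and an open neighborhood [W] of [y0] with [c <= f x y] for
     [x] in [U] and [y] in [W]. *)
  have [||U [W [[oU [x Ux]] UB [oW Wy0] fUW]]] := @quasi_box_le R Y X crY crX pY pX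
      (fun y x => - f x y) (fun x => continuousN_fun (@fY x))
      (fun y => continuousN_fun (@fX y))
      (quasi_continuous2N (quasi_continuous2_swap qf)) (nbhs y0) _
      (fun x => - f x y0) (fun x => @continuousN_fun _ _ _ (@fY x) y0) B (- b) (- c) oB B0.
    by rewrite /c; lra.
    by move=> V' _ [x Vx] VB; exists x => //; rewrite ltrN2; have [] := VB _ Vx.
  have [V [P' [[oV [v Vv]] VW [oP FP] fPV]]] : exists (V' : set Y) (P : set X),
      [/\ open V' /\ V' !=set0, V' `<=` W `&` \bigcap_(i in `I_n) pW (u i),
        open P /\ F P & forall x y, P x -> V' y -> f x y <= a].
    apply: H; apply: filterI => //.
    suff : nbhs y0 [set y | forall i : 'I_n, pW (u i) y].
      by apply: filterS => y yP i ilt; exact: (yP (Ordinal ilt)).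
    by apply: filter_forall => i; have [_ _ []] := uP i (ltn_ord i).
  exists ((x, U, W), (v, V, P')); split => //=.
  + split; first exact: open_nbhs_nbhs.
    by move=> i z /UB[/(_ i)].
  + split; first exact: open_nbhs_nbhs.
    by move=> i z /VW[_ /(_ i)]; apply; exact: ltn_ord.
  + by split => // z /VW[].
  + by move=> x' y' Ux' Wy'; rewrite -lerN2; exact: fUW.
have unb n : nbhs (px (u n)) (pU (u n)) by have [[]] := uP n.
have vnb n : nbhs (pv (u n)) (pV (u n)) by have [_ []] := uP n.
have [x xP] := pseudocompact_cluster crX pX unb.
have [y yP] := pseudocompact_cluster crY pY vnb.
(* Fixing the index of [V] and letting that of [U] grow gives [f x y <= a]; the opposite order below
   gives [c <= f x y]. *)
have : f x y <= a.
  apply: (cluster_le (N := 0) (@fY x) yP) => i y' _ Vy'.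
  apply: (cluster_le (N := i.+1) (@fX y') xP) => n x' ilt Ux'.
  have [_ _ _ _ [_]] := uP i; apply => //.
  by have [[_ /(_ (Ordinal ilt)) h] _ _ _ _] := uP n; exact: h.
have : - f x y <= - c.
  apply: (cluster_le (N := 0) (continuousN_fun (@fX y)) xP) => i x' _ Ux'.
  apply: (cluster_le (N := i) (continuousN_fun (@fY x')) yP) => n y' ilt Vy'.
  rewrite lerN2; have [_ _ _ h _] := uP i; apply: h => //.
  move: ilt; rewrite leq_eqVlt => /predU1P[->|ilt].
    by have [_ _ [_ h'] _ _] := uP n; exact: h'.
  by have [_ [_ /(_ (Ordinal ilt)) h'] _ _ _] := uP n; exact: h'.
rewrite /c; lra.
Qed.

(** If every [V] failed, it would contain an open [V0] in which the points with [g < c] are dense;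
    [quasi_box_le] would then bound [f] by [(c + d) / 2] on a box, against [quasi_no_jump]. *)
Lemma quasi_limit_ge (f : X -> Y -> R)
    (fX : forall y, continuous (f^~ y)) (fY : forall x, continuous (f x))
    (qf : quasi_continuous2 f) (F : set_system X) (FF : ProperFilter F)
    (g : Y -> R) (Fg : forall y, f x y @[x --> F] --> g y) (y0 : Y) (c d : R) :
  c < d -> d < g y0 -> exists2 V : set Y, nbhs y0 V &
    forall V0 : set Y, open V0 -> V0 !=set0 -> V0 `<=` V ->
    exists V' : set Y, [/\ open V', V' !=set0, V' `<=` V0 & forall y, V' y -> c <= g y].
Proof.
move=> cd dg; apply: contrapT => noV.
have [cm md] : c < (c + d) / 2 /\ (c + d) / 2 < d by split; lra.
apply: (quasi_no_jump fX fY qf FF Fg md dg) => V Vy0.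
apply: contrapT => H; apply: noV; exists V => // V0 oV0 V00 V0V.
apply: contrapT => H'; apply: H.
have [|V' [P [V'1 V'2 V'3 V'4]]] :=
    quasi_box_le crX crY pX pY fX fY qf FF Fg oV0 V00 cm.
  move=> V' oV' V'0 V'V0; apply: contrapT => H''; apply: H'.
  exists V'; split => // y Vy; rewrite leNgt; apply/negP => lt.
  by apply: H''; exists y.
by exists V', P; split => // z /V'2 /V0V.
Qed.

(** If [g y1 < c] for some [y1] near [y0], then [quasi_limit_ge] for [- f] at [y1] gives an open set
    with [g <= c + r], and for [f] at [y0] a nonempty open subset of it with [c + 2 * r <= g]. *)
Lemma quasi_limit_lsc (f : X -> Y -> R)
    (fX : forall y, continuous (f^~ y)) (fY : forall x, continuous (f x))
    (qf : quasi_continuous2 f) (F : set_system X) (FF : ProperFilter F)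
    (g : Y -> R) (Fg : forall y, f x y @[x --> F] --> g y) (y0 : Y) (c : R) :
  c < g y0 -> nbhs y0 [set y | c <= g y].
Proof.
move=> cg.
pose r := (g y0 - c) / 4.
have r0 : 0 < r by rewrite divr_gt0// subr_gt0.
have rE : g y0 = c + 4 * r by rewrite /r; lra.
have [||V Vy0 VP] := @quasi_limit_ge f fX fY qf F FF g Fg y0 (c + 2 * r) (c + 3 * r).
- by lra.
- by rewrite rE; lra.
move: Vy0; rewrite nbhsE => -[W [oW Wy0] WV]; exists W => // y1 Wy1 /=.
rewrite leNgt; apply/negP => gc.
have [||V1] := @quasi_limit_ge (fun x y => - f x y)
    (fun y => continuousN_fun (@fX y)) (fun x => continuousN_fun (@fY x))
    (quasi_continuous2N qf) F FF (fun y => - g y) (fun y => cvgN (Fg y)) y1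
    (- (c + r)) (- c).
- by lra.
- by lra.
rewrite nbhsE => -[W1 [oW1 W1y1] W1V1] V1P.
have [||V2 [oV2 V20 V2W gV2]] := V1P (W `&` W1) (openI oW oW1).
- by exists y1.
- by move=> z [_ /W1V1].
have [|V3 [_ [z V3z] V32 gV3]] := VP V2 oV2 V20.
  by move=> z /V2W[/WV].
by have := gV3 _ V3z; have := gV2 _ (V32 _ V3z); lra.
Qed.

Lemma quasi_limit_closed (f : X -> Y -> R)
    (fX : forall y, continuous (f^~ y)) (fY : forall x, continuous (f x)) :
  quasi_continuous2 f -> limit_closed f.
Proof.
move=> qf F g FF Fg y0; apply: dist_cvg => e e0.
have e20 : g y0 - e / 2 < g y0 by rewrite ltrBlDr ltrDl divr_gt0.
have e20' : - g y0 - e / 2 < - g y0 by rewrite ltrBlDr ltrDl divr_gt0.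
have h1 := quasi_limit_lsc fX fY qf FF Fg e20.
have h2 : nbhs y0 [set y | - g y0 - e / 2 <= - g y].
  apply: (@quasi_limit_lsc (fun x y => - f x y)
    (fun y => continuousN_fun (@fX y)) (fun x => continuousN_fun (@fY x))
    (quasi_continuous2N qf) F FF (fun y => - g y) (fun y => cvgN (Fg y)) _ _ e20').
apply: filterS2 h1 h2 => y /= y1 y2.
rewrite ltr_norml; apply/andP; split; lra.
Qed.

End quasi_limit.

(** * The Banach space of bounded functions *)

(** The value 0 keeps the set nonempty when [T] is empty. *)
Definition sup_norm (R : realType) (T : Type) (f : T -> R) : R :=
  sup [set r | r = 0 \/ exists x, r = `|f x|].

Section sup_norm.
Context (R : realType) (T : Type) (f : T -> R) (M : R).

Lemma sup_norm_le : 0 <= M -> (forall x, `|f x| <= M) -> sup_norm f <= M.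
Proof.
move=> M0 HM; apply: ge_sup; first by exists 0; left.
by move=> r [->|[x ->]].
Qed.

Hypothesis fM : forall x, `|f x| <= M.

Let has_sup_norm : has_sup [set r | r = 0 \/ exists x, r = `|f x|].
Proof.
split; first by exists 0; left.
exists (Num.max 0 M) => r [->|[x ->]]; first by rewrite le_max lexx.
by rewrite le_max fM orbT.
Qed.

Lemma le_sup_norm x : `|f x| <= sup_norm f.
Proof. by apply: sup_upper_bound has_sup_norm _ _; right; exists x. Qed.

Lemma sup_norm_ge0 : 0 <= sup_norm f.
Proof. by apply: sup_upper_bound has_sup_norm _ _; left. Qed.

End sup_norm.

Definition bounded_pred (R : realType) (T : Type) : {pred T -> R} :=
  [pred f | `[< exists M : R, forall x, `|f x| <= M >]].

Record bounded_map (R : realType) (T : Type) := BoundedMap {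
  bounded_map_val :> T -> R ;
  _ : bounded_map_val \in @bounded_pred R T
}.

Section bounded_maps.
Context (R : realType) (T : Type).
Local Notation V := (bounded_map R T).

HB.instance Definition _ := [isSub of V for @bounded_map_val R T].
HB.instance Definition _ := [Choice of V by <:].

Lemma bounded_mapP (f : V) : exists M : R, forall x, `|f x| <= M.
Proof. by apply/asboolP; case: f. Qed.

Lemma bounded_pred_submod : submod_closed (@bounded_pred R T).
Proof.
split; first by apply/asboolP; exists 0 => x; rewrite normr0.
move=> a f g /asboolP[M HM] /asboolP[N HN]; apply/asboolP.
exists (`|a| * M + N) => x; rewrite (le_trans (ler_normD _ _))// lerD//.
by rewrite normrM ler_wpM2l.
Qed.

HB.instance Definition _ :=
  GRing.isSubmodClosed.Build R (T -> R) (@bounded_pred R T) bounded_pred_submod.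
HB.instance Definition _ := [SubChoice_isSubLmodule of V by <:].

Lemma bounded_mapDE (f g : V) x : (f + g) x = f x + g x. Proof. by []. Qed.
Lemma bounded_mapZE a (f : V) x : (a *: f) x = a * f x. Proof. by []. Qed.
Lemma bounded_mapNE (f : V) x : (- f) x = - f x. Proof. by []. Qed.

Lemma le_sup_bounded_map (f : V) x : `|f x| <= sup_norm f.
Proof. by have [M fM] := bounded_mapP f; exact: (le_sup_norm fM). Qed.

Lemma sup_bounded_map_ge0 (f : V) : 0 <= sup_norm f.
Proof. by have [M fM] := bounded_mapP f; exact: (sup_norm_ge0 fM). Qed.

Lemma sup_normD (f g : V) : sup_norm (f + g : V) <= sup_norm f + sup_norm g.
Proof.
apply: sup_norm_le => [|x]; first by rewrite addr_ge0 ?sup_bounded_map_ge0.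
by rewrite bounded_mapDE (le_trans (ler_normD _ _))// lerD// le_sup_bounded_map.
Qed.

Lemma sup_normZ_le a (f : V) : sup_norm (a *: f : V) <= `|a| * sup_norm f.
Proof.
apply: sup_norm_le => [|x]; first by rewrite mulr_ge0 ?sup_bounded_map_ge0.
by rewrite bounded_mapZE normrM ler_wpM2l// le_sup_bounded_map.
Qed.

Lemma sup_normZ a (f : V) : sup_norm (a *: f : V) = `|a| * sup_norm f.
Proof.
have [->|a0] := eqVneq a 0.
  apply/eqP; rewrite eq_le sup_normZ_le andTb normr0 mul0r; exact: sup_bounded_map_ge0.
apply/eqP; rewrite eq_le sup_normZ_le andTb -ler_pdivlMl ?normr_gt0//.
rewrite -normfV; apply: le_trans (sup_normZ_le _ _).
by rewrite scalerA mulVf// scale1r.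
Qed.

Lemma sup_norm0_eq0 (f : V) : sup_norm f = 0 -> f = 0.
Proof.
move=> f0; apply/val_inj/funext => x /=.
by apply/eqP; rewrite -normr_le0 -f0; exact: le_sup_bounded_map.
Qed.

HB.instance Definition _ :=
  Lmodule_isNormed.Build R V sup_normD sup_normZ sup_norm0_eq0.

Lemma bounded_map_normE (f : V) : `|f| = sup_norm f. Proof. by []. Qed.

Lemma bounded_map_complete (F : set_system V) :
  ProperFilter F -> cauchy F -> cvg F.
Proof.
move=> FF /cauchyP Fc.
have evc (f : V) x (e : R) : F (ball f e) -> F [set h : V | `|h x - f x| < e].
  apply: filterS => h; rewrite -ball_normE /= bounded_map_normE => fh.
  by rewrite distrC; apply: le_lt_trans fh; exact: (le_sup_bounded_map (f - h) x).
have /choice[c cP] : forall x, exists l : R, (fun h : V => h x) @ F --> l.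
  move=> x; apply/cvg_ex; apply: cauchy_cvg; apply/cauchyP => e e0.
  have [f Ff] := Fc e e0; exists (f x); change (F [set h : V | ball (f x) e (h x)]).
  by apply: filterS (evc f x e Ff) => h /= fh; rewrite -ball_normE /= distrC.
have cle (f : V) (e : R) x : F (ball f e) -> `|c x - f x| <= e.
  move=> /(evc f x e) Ff.
  have fxc : (fun h : V => `|h x - f x|) @ F --> `|c x - f x|.
    by apply: cvg_norm; apply: cvgB; [exact: cP|exact: cvg_cst].
  by apply: (cvgr_to_le fxc); apply: filterS Ff => h /ltW.
have cb : c \in @bounded_pred R T.
  have [f Ff] := Fc 1 ltr01; have [M HM] := bounded_mapP f.
  apply/asboolP; exists (1 + M) => x.
  rewrite -[c x](subrK (f x)) (le_trans (ler_normD _ _))// lerD//.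
  exact: cle.
apply/cvg_ex; exists (BoundedMap cb); apply/cvgrPdist_le => e e0.
have e20 : 0 < e / 2 by rewrite divr_gt0.
have [f Ff] := Fc _ e20; apply: filterS (Ff) => h; rewrite -ball_normE /= => fh.
rewrite -(subrK f (BoundedMap cb)) -addrA (le_trans (ler_normD _ _))//.
rewrite [leRHS](splitr e) lerD// ?(ltW fh)//.
by rewrite bounded_map_normE; apply: sup_norm_le (ltW e20) _ => x; exact: cle.
Qed.

HB.instance Definition _ := Uniform_isComplete.Build V bounded_map_complete.

End bounded_maps.

(** * Bounded convergence *)

(* Simons' inequality.  With w n = 2^-n, choose u n in C n such that u n almost
   minimizes the sup norm of H n + w n |u n|, where H n is the sum of the
   w (i+1) |u i| for i < n.  If no member of C 0 is small, convexity keeps the gap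
   between the norm of H n and its limit s above a multiple of w n; but at a point
   where H n tends to s the remaining terms of the series are o(w n). *)
Lemma midpoint_family_small (R : realType) (Y : topologicalType)
    (crY : completely_regular_space Y) (pY : pseudocompact R Y)
    (C : nat -> set (Y -> R)) (B : R) :
  (forall n g, C n g -> continuous g) ->
  (forall n g y, C n g -> `|g y| <= B) ->
  (forall n, C n.+1 `<=` C n) ->
  (forall n, C n !=set0) ->
  (forall n g h, C n g -> C n h -> C n (fun y => (g y + h y) / 2)) ->
  (forall y (t : R), 0 < t -> exists n, forall g, C n g -> `|g y| <= t) ->
  forall D : R, 0 < D -> exists2 g, C 0%N g & forall y, `|g y| <= D.
Proof.
move=> Cc CB Canti C0 Cmid Csmall D D0; apply: contrapT => nsmall.
have big g : C 0%N g -> exists y, D < `|g y|.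
  move=> Cg; apply: contrapT => H; apply: nsmall; exists g => // y.
  by rewrite leNgt; apply/negP => lt; apply: H; exists y.
have [g0 C0g0] := C0 0%N.
have [y0 _] := big _ C0g0.
have B0 : 0 <= B by apply: le_trans (CB _ _ y0 C0g0).
have Cle n m : (n <= m)%N -> C m `<=` C n.
  elim: m => [|m IH]; first by rewrite leqn0 => /eqP->.
  by rewrite leq_eqVlt => /predU1P[->//|/IH nm g /Canti /nm].
pose w n : R := 2^-1 ^+ n.
have w0 n : 0 < w n by rewrite exprn_gt0// invr_gt0.
have wS n : w n.+1 = w n / 2 by rewrite /w exprSr.
have w1 n : w n <= 1 by rewrite /w exprn_ile1// ?invr_ge0// invf_le1// ler1n.
have wsmall (e : R) : 0 < e -> exists k, w k < e.
  move=> e0; exists (Num.truncn e^-1); rewrite /w exprVn invf_plt ?posrE ?exprn_gt0//.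
  apply: lt_le_trans (truncnS_gt _) _; rewrite -natrX ler_nat.
  exact: ltn_expl.
pose H n (u : nat -> Y -> R) y := \sum_(i < n) w i.+1 * `|u i y|.
pose E n u (g : Y -> R) y := H n u y + w n * `|g y|.
pose S (f : Y -> R) := sup_norm f.
(* With this [k], the errors [2 * k] in [sD] and at most [4 * k] in [gap] leave [D / 2] in
   [gap']. *)
pose k := D / 12.
have k0 : 0 < k by rewrite divr_gt0.
pose P n u g := C n g /\ forall g', C n g' -> S (E n u g) <= S (E n u g') + k * (w n * w n).
have H0 n u y : 0 <= H n u y.
  by apply: sumr_ge0 => i _; rewrite mulr_ge0// ltW.
have HB n u y : (forall i, (i < n)%N -> C i (u i)) -> H n u y <= (1 - w n) * B.
  elim: n => [_|n IH Cu]; first by rewrite /H big_ord0 /w expr0 subrr mul0r.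
  have := IH (fun i ilt => Cu i (leqW ilt)); rewrite /H big_ord_recr /= => h.
  have h1 : w n.+1 * `|u n y| <= w n.+1 * B.
    by rewrite ler_wpM2l// ?(ltW (w0 _))//; apply: (CB n); exact: Cu.
  move: h1; rewrite wS => h1; lra.
have EB n u g y : (forall i, (i < n)%N -> C i (u i)) -> C n g -> `|E n u g y| <= B.
  move=> Cu Cg; have h1 := HB n u y Cu.
  have h2 : w n * `|g y| <= w n * B by rewrite ler_wpM2l ?(ltW (w0 _))//; exact: CB Cg.
  have h3 : 0 <= w n * `|g y| by rewrite mulr_ge0// ltW.
  by rewrite /E ger0_norm ?addr_ge0//; lra.
have Hloc n u v : (forall i, (i < n)%N -> u i = v i) -> H n u = H n v.
  by move=> uv; apply/funext => y; apply: eq_bigr => i _; rewrite uv.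
have [||u uP] := @dependent_choice_seq _ g0 P.
- move=> n u v g uv [Cg gP]; split => // g' /gP; by rewrite /E (Hloc _ _ _ uv).
- move=> n u uP; have Cu i : (i < n)%N -> C i (u i) by move=> /uP[].
  pose A := [set r | exists2 g, C n g & r = S (E n u g)].
  have infA : has_inf A.
    split; first by have [g Cg] := C0 n; exists (S (E n u g)); exists g.
    by exists 0 => r [g Cg ->]; apply: (sup_norm_ge0 (fun y => EB n u g y Cu Cg)).
  have e0 : 0 < k * (w n * w n) by rewrite !mulr_gt0.
  have [r [g Cg ->] rA] := inf_adherent e0 infA.
  exists g; split => // g' Cg'; rewrite (le_trans (ltW rA))// lerD2r.
  by apply: inf_lbound; [exact: infA.2|exists g'].
have Cu i : C i (u i) by case: (uP i).
have Cui n i : (i < n)%N -> C i (u i) by [].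
pose N n := S (H n u).
have HBn n y : `|H n u y| <= B.
  rewrite ger0_norm// (le_trans (HB n u y (Cui n)))// ler_piMl// gerBl.
  exact: ltW (w0 n).
have HN n y : H n u y <= N n.
  by rewrite -[H n u y]ger0_norm//; exact: (le_sup_norm (HBn n)).
have N0 n : 0 <= N n by exact: (sup_norm_ge0 (HBn n)).
pose A n := S (E n u (u n)).
have EA n y : E n u (u n) y <= A n.
  apply: (le_trans (ler_norm _)).
  exact: (le_sup_norm (fun y => EB n u (u n) y (Cui n) (Cu n))).
have A0 n : 0 <= A n by exact: (sup_norm_ge0 (fun y => EB n u (u n) y (Cui n) (Cu n))).
have HS n y : H n.+1 u y = H n u y + w n.+1 * `|u n y| by rewrite /H big_ord_recr.
have ES n y : H n.+1 u y = (H n u y + E n u (u n) y) / 2.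
  by rewrite HS wS /E; lra.
have NS n : N n.+1 <= (N n + A n) / 2.
  apply: sup_norm_le => [|y]; first by rewrite divr_ge0// addr_ge0.
  by rewrite ger0_norm// ES ler_pM2r ?invr_gt0// lerD.
have AS n : A n <= A n.+1 + k * (w n * w n).
  (* The midpoint of [u n] and [u n.+1] competes with [u n] at stage [n]; as [w n] is twice
     [w n.+1], its norm there is at most that of [u n.+1] at stage [n.+1]. *)
  have Cm : C n (fun y => (u n y + u n.+1 y) / 2).
    by apply: Cmid => //; exact: Canti.
  apply: le_trans ((uP n).2 _ Cm) _; rewrite lerD2r.
  apply: sup_norm_le => // y.
  have EH : 0 <= E n u (fun y => (u n y + u n.+1 y) / 2) y.
    by rewrite addr_ge0// mulr_ge0// ltW.
  rewrite ger0_norm//; apply: le_trans (EA n.+1 y).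
  rewrite /E HS wS normrM [`|2^-1|]ger0_norm ?invr_ge0//.
  have h1 : w n * `|u n y + u n.+1 y| <= w n * (`|u n y| + `|u n.+1 y|).
    by rewrite ler_wpM2l ?(ltW (w0 _))// ler_normD.
  lra.
have AA n m : (n <= m)%N -> A n <= A m + 2 * k * (w n * w n) - 2 * k * (w m * w m).
  elim: m => [|m IH]; first by rewrite leqn0 => /eqP->; lra.
  rewrite leq_eqVlt => /predU1P[->|/IH]; first by lra.
  have := AS m; rewrite wS.
  have : 0 <= k * (w m * w m) by rewrite ltW// !mulr_gt0.
  lra.
pose s := sup (range N).
have hasN : has_sup (range N).
  split; first by exists (N 0%N); exists 0%N.
  by exists B => _ [n _ <-]; apply: sup_norm_le.
have Ns n : N n <= s by apply: sup_upper_bound => //; exists n.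
have Nmono n m : (n <= m)%N -> N n <= N m.
  elim: m => [|m IH]; first by rewrite leqn0 => /eqP->.
  rewrite leq_eqVlt => /predU1P[->//|/IH h]; apply: le_trans h _.
  apply: sup_norm_le => // y; rewrite ger0_norm//; apply: le_trans (HN m.+1 y).
  by rewrite HS lerDl mulr_ge0// ltW.
have As n : A n <= s + 2 * k * (w n * w n).
  apply/ler_addgt0Pr => e e0.
  have [m0 wm] : exists m, w m < e / (B + 1).
    by apply: wsmall; rewrite divr_gt0// ltr_wpDl.
  have [m nm wmB] : exists2 m, (n <= m)%N & w m * B <= e.
    exists (maxn n m0); first exact: leq_maxl.
    have wle : w (maxn n m0) <= w m0.
      by rewrite /w ler_wiXn2l ?invr_ge0 ?leq_maxr// invf_le1// ler1n.
    move: wm; rewrite ltr_pdivlMr ?ltr_wpDl// => wm.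
    have : w (maxn n m0) * B <= w m0 * B by rewrite ler_wpM2r.
    have := w0 m0; lra.
  have AN : A m <= N m + w m * B.
    apply: sup_norm_le => [|y]; first by rewrite addr_ge0// mulr_ge0// ltW.
    have h3 : 0 <= w m * `|u m y| by rewrite mulr_ge0// ltW.
    rewrite ger0_norm ?addr_ge0// lerD//.
    by rewrite ler_wpM2l ?(ltW (w0 _))//; exact: CB (Cu m).
  have := AA n m nm; have := Ns m.
  have : 0 <= k * (w m * w m) by rewrite ltW// !mulr_gt0.
  lra.
have sD : D - 2 * k <= s.
  have [y yD] := big _ (Cu 0%N); have := As 0%N.
  have := EA 0%N y; rewrite /E /H big_ord0 /w expr0; lra.
(* The correction [4 * k * (1 - w n)] absorbs the tolerances of the first [n] stages, so that the
   induction closes. *)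
have gap n : w n * (s - 4 * k * (1 - w n)) <= s - N n.
  elim: n => [|n IH].
    have -> : N 0%N = 0.
      apply/eqP; rewrite eq_le N0 andbT; apply: sup_norm_le => // y.
      by rewrite /H big_ord0 normr0.
    by rewrite /w expr0; lra.
  have := NS n; have := As n; rewrite wS; nra.
have gap' n : w n * (D / 2) <= s - N n.
  apply: le_trans (gap n); rewrite ler_wpM2l ?(ltW (w0 _))//.
  have : 0 <= k * w n by rewrite mulr_ge0// ltW.
  move: sD; rewrite /k; lra.
have [U UU tU] := tail_ultrafilter.
have FU : ProperFilter U by exact: ultra_proper.
have /choice[x xP] : forall m, exists x, N m - w m <= H m u x.
  move=> m; apply: contrapT => nx.
  have lex x : H m u x < N m - w m.
    by rewrite ltNge; apply/negP => le; apply: nx; exists x.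
  have : N m <= N m - w m.
    apply: sup_norm_le => [|x]; first by rewrite (le_trans (H0 m u y0))// ltW.
    by rewrite ger0_norm// ltW.
  by have := w0 m; lra.
have Hc n : continuous (H n u).
  elim: n => [|n IH] y.
    have -> : H 0%N u = cst 0 by apply/funext => z; rewrite /H big_ord0.
    exact: cvg_cst.
  have -> : H n.+1 u = fun z => H n u z + w n.+1 * `|u n z|.
    by apply/funext => z; rewrite HS.
  apply: cvgD; first exact: IH.
  by apply: cvgM; [exact: cvg_cst|apply: cvg_norm; exact: (Cc _ _ (Cu n))].
have [y yP] := pseudocompact_ultra_limit crY pY UU x Hc.
have tailH n m t z : (n <= m)%N -> (forall i, (n <= i)%N -> `|u i z| <= t) ->
    H m u z <= H n u z + t * (w n - w m).
  move=> + tP; elim: m => [|m IH]; first by rewrite leqn0 => /eqP->; lra.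
  rewrite leq_eqVlt => /predU1P[->|nm]; first by lra.
  have h := IH nm; rewrite HS wS.
  have : w m * `|u m z| <= w m * t by rewrite ler_wpM2l ?(ltW (w0 _))// tP.
  lra.
have Hy n : s - B * w n <= H n u y.
  apply/ler_addgt0Pr => e e0.
  have e20 : 0 < e / 2 by rewrite divr_gt0.
  have [_ [n1 _ <-] sn1] := sup_adherent e20 hasN.
  have [n2 wn2] := wsmall _ e20.
  suff h : s - B * w n - e <= H n u y by lra.
  apply: (cvgr_to_ge (yP n)).
  apply: filterS (tU (maxn n (maxn n1 n2))) => m /=.
  rewrite !geq_max => /andP[nm /andP[n1m n2m]].
  have wle : w m <= w n2.
    by rewrite /w ler_wiXn2l ?invr_ge0// invf_le1// ler1n.
  have h1 := tailH n m B (x m) nm (fun i _ => CB _ _ (x m) (Cu i)).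
  have h2 := xP m; have h3 := Nmono _ _ n1m.
  have h4 : 0 <= B * w m by rewrite mulr_ge0// ltW.
  move: sn1; rewrite -/s; lra.
have D40 : 0 < D / 4 by rewrite divr_gt0.
have [n nP] := Csmall y (D / 4) D40.
have un i : (n <= i)%N -> `|u i y| <= D / 4.
  by move=> ni; apply: nP; exact: Cle ni _ (Cu i).
(* From rank [n] on the terms are at most [D / 4] at [y], so the tail adds at most [D / 4 * w n],
   half of what [gap'] requires. *)
have sN : s <= N n + D / 4 * w n.
  apply/ler_addgt0Pr => e e0.
  have [m0 wm] : exists m, w m < e / (B + 1).
    by apply: wsmall; rewrite divr_gt0// ltr_wpDl.
  move: wm; rewrite ltr_pdivlMr ?ltr_wpDl// => wm.
  have wle : w (maxn n m0) <= w m0.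
    by rewrite /w ler_wiXn2l ?invr_ge0 ?leq_maxr// invf_le1// ler1n.
  have h1 := tailH n (maxn n m0) _ y (leq_maxl _ _) un.
  have h2 := Hy (maxn n m0); have h3 := HN n y.
  have h4 : w (maxn n m0) * B <= w m0 * B by rewrite ler_wpM2r.
  have h5 : 0 <= D * w (maxn n m0) by rewrite mulr_ge0// ltW.
  have := w0 m0; lra.
have := gap' n; have : 0 < D * w n by rewrite mulr_gt0.
lra.
Qed.

(** * Initial topologies *)

Lemma cvg_initial (S : choiceType) (T : topologicalType) (w : S -> T)
    (F : set_system S) (FF : Filter F) (s : S) :
  w @ F --> w s -> F --> (s : initial_topology w).
Proof.
move=> wF N; rewrite nbhsE => -[_ [[A oA <-] /= As] AN].
by apply: filterS AN _; apply: wF; exact: open_nbhs_nbhs.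
Qed.

(** Serves both [{ptws T -> R}] and [weak_space], which are suprema of initial topologies. *)
Lemma cvg_sup_initial (S : choiceType) (I : Type) (T : I -> topologicalType)
    (w : forall i, S -> T i) (F : set_system S) (FF : Filter F) (s : S) :
  (forall i, w i @ F --> w i s) ->
  F --> (s : sup_topology (fun i => Topological.class (initial_topology (w i)))).
Proof. by move=> wF; apply/cvg_sup => i; exact: cvg_initial. Qed.

Lemma sup_initial_continuous (S : choiceType) (I : Type) (T : I -> topologicalType)
    (w : forall i, S -> T i) (i : I) :
  continuous (w i : sup_topology (fun i =>
    Topological.class (initial_topology (w i))) -> T i).
Proof.
move=> s; apply: cvg_trans (@initial_continuous S (T i) (w i) s).
apply: cvg_app.
have /cvg_sup : nbhs (s : sup_topology (fun i =>
    Topological.class (initial_topology (w i)))) --> nbhs (s : sup_topology (fun i =>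
    Topological.class (initial_topology (w i)))) by exact: cvg_id.
exact.
Qed.

Section cp_topology.
Context (R : realType) (Y : topologicalType).

Lemma cvg_ptws (T : Type) (F : set_system (T -> R)) (FF : Filter F) (p : T -> R) :
  (forall y, k y @[k --> F] --> p y) -> F --> (p : {ptws T -> R}).
Proof. by move=> Fp; exact: (@cvg_sup_initial (T -> R) T (fun=> R) (fun y k => k y)). Qed.

Lemma ptws_eval_continuous (T : Type) (y : T) :
  continuous (fun k : {ptws T -> R} => k y).
Proof. exact: (@sup_initial_continuous (T -> R) T (fun=> R) (fun y k => k y) y). Qed.

Lemma cvg_Cp (F : set_system (Cp R Y)) (FF : Filter F) (p : Cp R Y) :
  (forall y, (k : continuousType Y R) y @[k --> F] --> (p : continuousType Y R) y) ->
  F --> p.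
Proof.
move=> Fp; apply: cvg_initial; apply: cvg_ptws => y; exact: Fp.
Qed.

Lemma Cp_eval_continuous y :
  continuous (fun k : Cp R Y => (k : continuousType Y R) y).
Proof.
move=> k; apply: (@continuous_comp _ _ _
  (fun k : Cp R Y => (k : continuousType Y R) : {ptws Y -> R}) (fun k => k y)).
  exact: initial_continuous.
exact: ptws_eval_continuous.
Qed.

Lemma Cp_hausdorff : hausdorff_space (Cp R Y).
Proof.
move=> p q pq; apply/continuousEP => y.
apply: (@norm_hausdorff R R^o) => A B.
move=> /(@Cp_eval_continuous y p) Ap /(@Cp_eval_continuous y q) Bq.
by have [k [Ak Bk]] := pq _ _ Ap Bq; exists ((k : continuousType Y R) y).
Qed.

End cp_topology.

Section weak_topology.
Context (R : realType) (V : normedModType R).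

Lemma cvg_weak (F : set_system (weak_space V)) (FF : Filter F) (v : weak_space V) :
  (forall l : {linear V -> R^o}, continuous l -> (l : V -> R) @ F --> l v) -> F --> v.
Proof.
move=> Fv; apply: (@cvg_sup_initial V {f : {linear V -> R^o} | continuous f}
  (fun=> R) (fun f => (sval f : V -> R))) => - [l lc].
exact: Fv.
Qed.

Lemma weak_continuous (l : {linear V -> R^o}) : continuous l ->
  continuous ((l : V -> R) : weak_space V -> R).
Proof.
move=> lc; exact: (@sup_initial_continuous V {f : {linear V -> R^o} | continuous f}
  (fun=> R) (fun f => (sval f : V -> R)) (exist _ l lc)).
Qed.

End weak_topology.

(** * Weak compactness of the set of rows *)

(** Otherwise [e <= |l (v n)|] for some [e > 0] and infinitely many [n]; after sign changes, [l] is
    at least [e] on all midpoint combinations of these [v n]. By [midpoint_family_small] some member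
    of the family has norm at most [e / 2 / M], where [M] bounds [l]. *)
Lemma weak_bounded_convergence (R : realType) (Y : topologicalType)
    (crY : completely_regular_space Y) (pY : pseudocompact R Y)
    (l : {linear bounded_map R Y -> R^o}) (lc : continuous l)
    (v : nat -> bounded_map R Y) (B : R) :
  (forall n, continuous (v n : Y -> R)) -> (forall n y, `|v n y| <= B) ->
  (forall y, v n y @[n --> \oo] --> (0 : R)) ->
  (l (v n) : R) @[n --> \oo] --> (0 : R).
Proof.
move=> vc vB v0; apply: dist_cvg => e e0; apply: contrapT => nN.
have freq N : exists2 n, (N <= n)%N & e <= `|l (v n)|.
  apply: contrapT => H; apply: nN; exists N => // n Nn /=.
  by rewrite subr0 ltNge; apply/negP => le; apply: H; exists n.
have [M M0 lM] : exists2 M : R, 0 < M & forall x, `|l x| <= M * `|x|.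
  have /linear_boundedP lb := continuous_linear_bounded 0 (lc 0).
  have [M [M0 lM]] := filter_ex (filterI (nbhs_pinfty_gt (num_real (0 : R))) lb).
  by exists M.
(* The last condition bounds [g] pointwise by the supremum of the tail of [v]; it survives midpoints
   and replaces explicit convex combinations. *)
pose C n : set (Y -> R) := [set g | continuous g /\ exists x : bounded_map R Y,
  [/\ (x : Y -> R) = g, e <= l x &
   forall y (t : R), (forall k, (n <= k)%N -> `|v k y| <= t) -> `|g y| <= t]].
have D0 : 0 < e / 2 / M by rewrite !divr_gt0.
have [|||||| g [gc [x [xg lx _]]] gD] :=
    @midpoint_family_small R Y crY pY C B _ _ _ _ _ _ _ D0.
- by move=> n g [].
- by move=> n g y [_ [x [_ _]]]; apply=> k _.
- move=> n g [gc [x [xg lx H]]]; split => //; exists x; split => // y t vt.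
  by apply: H => k /ltnW; exact: vt.
- move=> n; have [m nm em] := freq n.
  have [l0|l0] := leP 0 (l (v m) : R).
    exists (v m : Y -> R); split; first exact: vc.
    exists (v m); split => //; first by rewrite -(ger0_norm l0).
    by move=> y t; apply.
  exists (- v m : bounded_map R Y); split.
    by apply: continuousN_fun; exact: vc.
  exists (- v m); split => //; first by rewrite linearN -(ltr0_norm l0).
  by move=> y t vt; rewrite bounded_mapNE normrN; exact: vt.
- move=> n g h [gc [x [xg lx H]]] [hc [z [zh lz H']]]; split.
    move=> y; apply: cvgM; last exact: cvg_cst.
    by apply: cvgD; [exact: gc|exact: hc].
  exists (2^-1 *: (x + z)); split.
  + by apply/funext => y; rewrite bounded_mapZE bounded_mapDE xg zh mulrC.
  + have -> : l (2^-1 *: (x + z)) = 2^-1 * (l x + l z) by rewrite linearZ linearD.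
    by lra.
  + move=> y t vt; rewrite normrM [`|2^-1|]ger0_norm ?invr_ge0//.
    have := H y t vt; have := H' y t vt; have := ler_normD (g y) (h y); lra.
- move=> y t t0; have [N _ HN] := cvg_dist eventually_filter (v0 y) t0.
  exists N => g [_ [x [_ _]]]; apply => k /HN /=; rewrite subr0; exact: ltW.
have : e <= M * (e / 2 / M).
  apply: (le_trans lx); apply: (le_trans (ler_norm _)); apply: (le_trans (lM _)).
  rewrite ler_pM2l// bounded_map_normE; apply: sup_norm_le; first exact: ltW.
  by move=> y; rewrite xg.
by rewrite mulrC divfK ?gt_eqF//; lra.
Qed.

Lemma compact_set_type (T : topologicalType) (A : set T) :
  compact A -> compact [set: set_type A].
Proof.
move=> cA F FF _.
have FA : (set_val @ F) A by apply: (@filterE _ F) => a; exact: set_valP.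
have [p [Ap clp]] := cA _ _ FA.
exists (exist _ p (mem_set Ap)); split => // B N FB.
rewrite nbhsE => -[_ [[Q oQ <-] /= Qp] QN].
have FB' : (set_val @ F) (set_val @` B).
  by apply: (@filterS _ F _ B) FB => b Bb; exists b.
have [_ [[b Bb <-] Qb]] := clp _ _ FB' (open_nbhs_nbhs (conj oQ Qp)).
by exists b; split => //; exact: QN.
Qed.

(* Phi is bounded in each variable but not jointly, and bounded convergence needs a
   uniform bound: rows are embedded after composition with t / (1 + |t|). *)
Section squash.
Context (R : realType).

Definition squash (t : R) : R := t / (1 + `|t|).
Definition unsquash (t : R) : R := t / (1 - `|t|).

Let den_gt0 (t : R) : 0 < 1 + `|t|.
Proof. by rewrite ltr_wpDr. Qed.

Lemma norm_squash t : `|squash t| = `|t| / (1 + `|t|).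
Proof. by rewrite /squash normrM normfV (ger0_norm (ltW (den_gt0 t))). Qed.

Lemma norm_squash_lt1 t : `|squash t| < 1.
Proof. by rewrite norm_squash ltr_pdivrMr// mul1r ltrDr. Qed.

Lemma squashK : cancel squash unsquash.
Proof.
move=> t; rewrite /unsquash norm_squash.
have d0 := lt0r_neq0 (den_gt0 t).
have -> : 1 - `|t| / (1 + `|t|) = (1 + `|t|)^-1.
  by apply: (mulIf d0); rewrite mulrBl divfK// mulVf// mul1r addrK.
by rewrite invrK /squash divfK.
Qed.

Lemma squash_continuous : continuous squash.
Proof.
move=> t; apply: cvgM; first exact: cvg_id.
apply: cvgV; first exact: lt0r_neq0 (den_gt0 t).
by apply: cvgD; [exact: cvg_cst|apply: cvg_norm; exact: cvg_id].
Qed.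

Lemma unsquash_continuous t : `|t| < 1 -> unsquash x @[x --> t] --> unsquash t.
Proof.
move=> t1; apply: cvgM; first exact: cvg_id.
apply: cvgV; first by rewrite subr_eq0 gt_eqF.
by apply: cvgB; [exact: cvg_cst|apply: cvg_norm; exact: cvg_id].
Qed.

Lemma squash_bounded (T : Type) (g : T -> R) : squash \o g \in @bounded_pred R T.
Proof. by apply/asboolP; exists 1 => x; exact: ltW (norm_squash_lt1 _). Qed.

Definition squash_map (T : Type) (g : T -> R) : bounded_map R T :=
  BoundedMap (squash_bounded g).

End squash.

Definition bounded_eval (R : realType) (T : Type) (y : T) (v : bounded_map R T) : R^o :=
  v y.

Lemma bounded_eval_linear (R : realType) (T : Type) (y : T) :
  linear (@bounded_eval R T y).
Proof. by []. Qed.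

HB.instance Definition _ (R : realType) (T : Type) (y : T) :=
  GRing.isLinear.Build R (bounded_map R T) R^o _ (@bounded_eval R T y)
    (@bounded_eval_linear R T y).

Lemma bounded_eval_continuous (R : realType) (T : Type) (y : T) :
  continuous (@bounded_eval R T y).
Proof.
move=> v; have FF : Filter (nbhs v) := nbhs_filter v.
apply/cvgrPdist_le => e e0.
have vv : (w : bounded_map R T) @[w --> v] --> v by exact: cvg_id.
have /cvgrPdist_le/(_ e e0) := vv.
apply: (@filterS _ _ (nbhs_filter v)) => w; apply: le_trans.
exact: (le_sup_bounded_map (v - w) y).
Qed.

Section eberlein.
Context (R : realType) (X Y : topologicalType).
Hypotheses (crX : completely_regular_space X) (crY : completely_regular_space Y)
  (pX : pseudocompact R X) (pY : pseudocompact R Y).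
Context (f : X -> Y -> R).
Hypotheses (fX : forall y, continuous (f^~ y)) (fY : forall x, continuous (f x)).
Hypothesis lcf : limit_closed f.
Context (phi : X -> Cp R Y).
Hypothesis phiE : forall x y, (phi x : continuousType Y R) y = f x y.

Lemma limit_closed_range_compact : compact (range phi).
Proof.
rewrite compact_ultra => G UG Gphi.
have FG : ProperFilter G by exact: ultra_proper.
have [_ [x0 _ _]] := filter_ex Gphi.
(* The ultrafilter is carried back to [X] by a choice of preimages; [x0] is the default off the
   range. *)
have /choice[s sP] : forall k : Cp R Y, exists x, range phi k -> phi x = k.
  move=> k; have [[x _ xk]|nk] := pselect (range phi k); first by exists x.
  by exists x0 => /nk.
have [g gc gP] := limit_closed_ultra (fun y => pX (@fX y)) UG s lcf.
have [x xg] := limit_attained crX crY pX pY fX fY lcf (F := s @ G) _ gP.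
exists (phi x); split; first by exists x.
apply: cvg_Cp => y; rewrite phiE xg.
apply: cvg_trans (gP y); apply: near_eq_cvg; apply: filterS Gphi => k /sP kE.
by rewrite -phiE kE.
Qed.

Let iota (k : set_type (range phi)) : weak_space (bounded_map R Y) :=
  squash_map (set_val k : continuousType Y R).

Let iota_inj : injective iota.
Proof.
move=> k k' kk'; apply: val_inj; apply/continuousEP => y.
apply: (can_inj (@squashK R)).
exact: (congr1 (fun v : bounded_map R Y => v y) kk').
Qed.

(** If [l] composed with [iota] is discontinuous at [k0], then [k0] is a pointwise limit of rows at
    which it stays [e] away from its value at [k0]; [sequential_approximation] extracts a sequence
    of them, and [weak_bounded_convergence] gives a contradiction. *)
Let iota_continuous : continuous iota.
Proof.
move=> k0; apply: (cvg_weak (fmap_filter iota (nbhs_filter k0))) => l lc; apply: dist_cvg => e e0; apply: contrapT => nk.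
pose S := [set x | exists2 k, set_val k = phi x & e <= `|l (iota k) - l (iota k0)|].
have g0c : continuous (set_val k0 : continuousType Y R) by exact: cts_fun.
have [|a aS aP] := sequential_approximation crY pX pY fX fY lcf (S := S) g0c.
  move=> s d d0; apply: contrapT => nS; apply: nk.
  have : nbhs k0 [set k | forall y, y \in s ->
      `|(set_val k : continuousType Y R) y - (set_val k0 : continuousType Y R) y| < d].
    apply: (filter_seq (nbhs_filter k0)) => y _; apply: continuous_dist => // k.
    apply: (@continuous_comp _ _ _ set_val
      (fun k : Cp R Y => (k : continuousType Y R) y)).
      exact: initial_continuous.
    exact: Cp_eval_continuous.
  apply: (@filterS _ _ (nbhs_filter k0)) => k kP /=; rewrite ltNge; apply/negP => le; apply: nS.
  have [x _ xk] := set_valP k; exists x; first by exists k.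
  by move=> y ys; rewrite -phiE xk; exact: kP.
have /choice[k /all_and2[kE kP]] : forall n, exists k : set_type (range phi),
    set_val k = phi (a n) /\ e <= `|l (iota k) - l (iota k0)|.
  by move=> n; have [k kE kP] := aS n; exists k.
pose v n : bounded_map R Y := iota (k n) - iota k0.
have vE n y : v n y = squash (f (a n) y) - squash ((set_val k0 : continuousType Y R) y).
  by rewrite -phiE -kE.
have : (l (v n) : R) @[n --> \oo] --> (0 : R).
  apply: (weak_bounded_convergence crY pY lc (B := 2)) => [n|n y|y].
  - have -> : (v n : Y -> R) = (fun y => squash (f (a n) y) -
        squash ((set_val k0 : continuousType Y R) y)).
      by apply/funext => z; exact: vE.
    have sqc (g : Y -> R) : continuous g -> continuous (fun y => squash (g y)).
      by move=> gc y; exact: cvg_comp (gc y) (@squash_continuous R (g y)).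
    move=> y; apply: (@cvgB _ _ _ (nbhs y)).
      by apply: sqc; exact: fY.
    by apply: sqc; exact: g0c.
  - rewrite vE (le_trans (ler_normB _ _))//.
    have := norm_squash_lt1 (f (a n) y).
    have := norm_squash_lt1 ((set_val k0 : continuousType Y R) y); lra.
  - under eq_cvg do rewrite vE.
    set c := squash _.
    have : (squash (f (a n) y) - c) @[n --> \oo] --> (c - c).
      by apply: cvgB (cvg_cst c); exact: cvg_comp (aP y) (@squash_continuous R _).
    by rewrite subrr.
move=> /(cvg_dist eventually_filter)/(_ e e0)[N _ /(_ N (leqnn N))] /=.
by rewrite subr0 linearB ltNge kP.
Qed.

(** The inverse of [iota] is continuous since the value of a row at [y] is [unsquash] of the
    evaluation at [y], a norm-continuous functional. *)
Lemma limit_closed_range_eberlein : eberlein_compactum R (set_type (range phi)).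
Proof.
have cK := compact_set_type limit_closed_range_compact.
split => //; exists (bounded_map R Y), (range iota); split.
  by apply: continuous_compact => //; apply: continuous_subspaceT.
pose F (k : set_type (range phi)) : set_type (range iota) :=
  exist _ (iota k) (mem_set (ex_intro2 _ _ k Logic.I erefl)).
have /choice[G GE] : forall a : set_type (range iota), exists k, iota k = set_val a.
  by move=> a; have [k _ ka] := set_valP a; exists k.
have FK : cancel F G by move=> k; apply: iota_inj; rewrite GE.
have GK : cancel G F by move=> a; apply: val_inj; exact: GE.
exists F, G; split => //.
  by apply: continuous_comp_initial; exact: iota_continuous.
apply: continuous_comp_initial => a.
apply: (cvg_Cp (fmap_filter _ (nbhs_filter a))) => y.
have Gy b : (set_val (G b) : continuousType Y R) y =
    unsquash (bounded_eval y (set_val b : bounded_map R Y)).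
  by rewrite -GE /bounded_eval /= squashK.
have GyE : (fun b => (set_val (G b) : continuousType Y R) y) =
    (fun b => unsquash (bounded_eval y (set_val b : bounded_map R Y))).
  by apply/funext.
change ((fun b => (set_val (G b) : continuousType Y R) y) @ a -->
  (fun b => (set_val (G b) : continuousType Y R) y) a).
rewrite GyE.
apply: (@continuous_comp _ _ _
  (fun b : set_type (range iota) => bounded_eval y (set_val b : bounded_map R Y) : R)).
  apply: (@continuous_comp _ _ _ set_val); first exact: initial_continuous.
  by apply: weak_continuous; exact: bounded_eval_continuous.
apply: unsquash_continuous; rewrite -GE; exact: norm_squash_lt1.
Qed.

End eberlein.

(** * The Stone-Cech compactification *)

Section stone_cech_theory.
Context (R : realType) (X : topologicalType).
Local Notation bX := (stone_cech R X).
Local Notation toB := (to_stone_cech R).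

Definition stone_cech_coord (p : bX) : unit_function R X -> R := set_val p.

Lemma stone_cech_coord_continuous u : continuous (fun p : bX => stone_cech_coord p u).
Proof.
move=> p; apply: (@continuous_comp _ _ _ set_val
  (fun k : {ptws unit_function R X -> R} => k u)).
  exact: initial_continuous.
exact: ptws_eval_continuous.
Qed.

Lemma cvg_stone_cech (F : set_system bX) (FF : Filter F) (p : bX) :
  (forall u, stone_cech_coord q u @[q --> F] --> stone_cech_coord p u) -> F --> p.
Proof. by move=> Fp; apply: cvg_initial; exact: cvg_ptws. Qed.

Lemma to_stone_cech_continuous : continuous (toB : X -> bX).
Proof.
move=> x; apply: (cvg_stone_cech (fmap_filter _ (nbhs_filter x))) => u.
by case: u => u [uc u01]; exact: uc.
Qed.

Lemma to_stone_cech_dense (p : bX) (N : set bX) :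
  nbhs p N -> exists x, N (toB x).
Proof.
rewrite nbhsE => -[_ [[Q oQ <-] /= Qp] QN].
have [_ [[x _ <-] Qx]] := set_valP p _ (open_nbhs_nbhs (conj oQ Qp)).
by exists x; exact: QN.
Qed.

(** The ambient product is a power of the whole line, so the bound is carried over from the dense
    image of [X]. *)
Lemma stone_cech_coord_le1 (p : bX) u : `|stone_cech_coord p u| <= 1.
Proof.
rewrite leNgt; apply/negP => p1.
have e0 : 0 < `|stone_cech_coord p u| - 1 by rewrite subr_gt0.
have [x /=] := to_stone_cech_dense (continuous_dist (@stone_cech_coord_continuous u) p e0).
have xu : `|stone_cech_coord (toB x) u| <= 1.
  by case: u {p1 e0} => u [uc /= u01]; have /andP[u0 u1] := u01 x; rewrite ger0_norm.
have := ler_distD (stone_cech_coord (toB x) u) (stone_cech_coord p u) 0.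
rewrite !subr0 (distrC (stone_cech_coord p u)); lra.
Qed.

Lemma stone_cech_compact : compact [set: bX].
Proof.
rewrite compact_ultra => G UG _.
have FG : ProperFilter G by exact: ultra_proper.
have /choice[c cP] : forall u, exists l : R, stone_cech_coord q u @[q --> G] --> l.
  by move=> u; apply: ultra_bounded_cvg => q; exact: stone_cech_coord_le1.
have Gc : stone_cech_coord @ G --> (c : {ptws unit_function R X -> R}).
  exact: cvg_ptws.
have cc : closure (range (@cube_eval R X)) c.
  move=> N; rewrite nbhsE => -[Q [oQ Qc] QN].
  have GQ : G (@stone_cech_coord @^-1` Q) := Gc Q (open_nbhs_nbhs (conj oQ Qc)).
  have [q Qq] := filter_ex GQ.
  have [z [rz Qz]] := set_valP q Q (open_nbhs_nbhs (conj oQ Qq)).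
  by exists z; split => //; exact: QN.
exists (exist _ c (mem_set cc)); split => //.
by apply: cvg_stone_cech => u; exact: cP.
Qed.

Lemma stone_cech_extension (h : X -> R) (M : R) : continuous h ->
  (forall x, `|h x| <= M) ->
  exists2 g : bX -> R, continuous g & forall x, g (toB x) = h x.
Proof.
move=> hc hM.
(* The added 1 makes [N] positive, so that [h] can be rescaled affinely into the unit interval. *)
pose N := `|M| + 1.
have N0 : 0 < N by rewrite ltr_wpDl.
have hN x : - N <= h x <= N.
  rewrite -ler_norml (le_trans (hM x))// (le_trans (ler_norm M))//.
  by rewrite lerDl.
pose u x := (h x + N) / (2 * N).
have uc : continuous u.
  move=> x; apply: cvgM; last exact: cvg_cst.
  by apply: cvgD; [exact: hc|exact: cvg_cst].
have u01 x : 0 <= u x <= 1.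
  have /andP[h1 h2] := hN x.
  by rewrite /u divr_ge0 ?ler_pdivrMr ?mulr_gt0//=; lra.
pose v : unit_function R X := exist _ u (conj uc u01).
exists (fun p => stone_cech_coord p v * (2 * N) - N).
  move=> p; have FF : Filter (nbhs p) := nbhs_filter p.
  apply: cvgB; last exact: cvg_cst.
  apply: (@cvgM _ _ (nbhs p)); last exact: cvg_cst.
  exact: (@stone_cech_coord_continuous v p).
move=> x; rewrite /stone_cech_coord /= /cube_eval /= /u divfK ?addrK//.
by apply: lt0r_neq0; rewrite mulr_gt0.
Qed.

(** Each [f^~ y] is bounded and extends to the compactification. The row at [p] is then the limit of
    the rows of [f] along the trace on [X] of the neighborhoods of [p], hence continuous. *)
Lemma limit_closed_extension (Y : topologicalType) (f : X -> Y -> R) :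
  pseudocompact R X -> (forall y, continuous (f^~ y)) -> limit_closed f ->
  exists g : bX -> Y -> R, [/\ forall y, continuous (g^~ y),
    forall p, continuous (g p) & forall x y, g (toB x) y = f x y].
Proof.
move=> pX fX lcf.
have /choice[g gP] : forall y, exists g : bX -> R, continuous g /\
    forall x, g (toB x) = f x y.
  move=> y; have [M fM] := pX _ (@fX y).
  by have [g gc gE] := stone_cech_extension (@fX y) fM; exists g.
exists (fun p y => g y p); split => [y|p|x y]; [exact: (gP y).1| |exact: (gP y).2].
have FF : ProperFilter (filter_from (nbhs p) (fun N => toB @^-1` N)).
  apply: filter_from_proper; last by move=> N /to_stone_cech_dense[x Nx]; exists x.
  apply: filter_from_filter; first by exists setT; exact: filterT.
  by move=> A B pA pB; exists (A `&` B) => //; exact: filterI.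
apply: (lcf _ _ FF) => y; apply: dist_cvg => e e0.
exists [set q | `|g y q - g y p| < e]; first exact: continuous_dist (gP y).1 _ _ _.
by move=> x /=; rewrite (gP y).2.
Qed.

End stone_cech_theory.

(** * Consequences of compactness and of joint continuity *)

(** A limit of rows along [F] is the row [g k] at a cluster point [k] of the image filter. [K] will
    be a function space or a Stone-Cech compactification. *)
Lemma compact_limit_closed (R : realType) (X : Type) (K Y : topologicalType)
    (A : set K) (f : X -> Y -> R) (t : X -> K) (g : K -> Y -> R) :
  compact A -> (forall x, A (t x)) -> (forall y, continuous (g^~ y)) ->
  (forall k, continuous (g k)) -> (forall x y, g (t x) y = f x y) ->
  limit_closed f.
Proof.
move=> cA At gK gY gf F h FF Fh.
have FA : (t @ F) A by apply: (@filterE _ F).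
have [k [_ clk]] := cA (t @ F) _ FA.
suff -> : h = g k by exact: gY.
apply/funext => y; apply: dist_eps_eq => e e0.
have e20 : 0 < e / 2 by rewrite divr_gt0.
have F1 : (t @ F) (t @` [set x | `|f x y - h y| < e / 2]).
  by apply: (@filterS _ F _ _ _ _ (cvg_dist FF (Fh y) e20)) => x xP; exists x.
have [_ [[x /= xh <-] /= xk]] := clk _ _ F1 (continuous_dist (@gK y) k e20).
have := ler_distD (f x y) (h y) (g k y).
rewrite (distrC (h y) (f x y)) -gf; move: xh; rewrite -gf; lra.
Qed.

Lemma compact_pseudocompact (R : realType) (K : topologicalType) :
  compact [set: K] -> pseudocompact R K.
Proof.
move=> cK f fc.
have [M [_ HM]] : bounded_set (f @` setT : set R^o).
  apply: compact_bounded; apply: continuous_compact => //.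
  exact: continuous_subspaceT.
exists (M + 1) => x; apply: (HM (M + 1)); first by rewrite ltrDl.
by exists x.
Qed.

(** Continuity of [f x] gives a point [y'] of [D] near [y] with [f x y'] close to [f x y]; joint
    continuity at [(x, y')] then gives the box. *)
Lemma dense_joint_quasi (R : realType) (X Y : topologicalType) (f : X -> Y -> R)
    (D : set Y) : (forall x, continuous (f x)) -> dense D ->
  (forall x y (e : R), D y -> 0 < e ->
     nbhs (x, y) [set z : X * Y | `|f z.1 z.2 - f x y| < e]) ->
  quasi_continuous2 f.
Proof.
move=> fY dD jD x y U V e xU yV e0.
have e20 : 0 < e / 2 by rewrite divr_gt0.
have := @filterI _ _ (nbhs_filter y) _ _ yV (continuous_dist (@fY x) y e20).
rewrite nbhsE => -[W [oW Wy] WV].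
have [y' [Wy' Dy']] := dD W (ex_intro _ y Wy) oW.
have [[A B] /= [xA yB] AB] := jD x y' _ Dy' e20.
have [/= Vy' fy'] := WV _ Wy'.
exists (A^° `&` U^°), (B^° `&` W); split.
- split; first by apply: openI; exact: open_interior.
  by exists x; split; [exact: xA|exact: xU].
- split; first by apply: openI => //; exact: open_interior.
  by exists y'; split => //; exact: yB.
- by move=> z [_ /interior_subset].
- by move=> z [_ /WV[]].
- move=> x1 y1 [/interior_subset Ax1 _] [/interior_subset By1 _].
  have /= := AB (x1, y1) (conj Ax1 By1).
  have := ler_distD (f x y') (f x1 y1) (f x y); lra.
Qed.

Lemma uniform_joint_continuous (R : realType) (X Y : topologicalType)
    (f : X -> Y -> R) (x : X) (y : Y) (e : R) : continuous (f x) ->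
  (forall e : R, 0 < e -> nbhs x [set x' | forall y, `|f x' y - f x y| <= e]) ->
  0 < e -> nbhs (x, y) [set z : X * Y | `|f z.1 z.2 - f x y| < e].
Proof.
move=> fc fx e0; have e20 : 0 < e / 2 by rewrite divr_gt0.
exists ([set x' | forall y, `|f x' y - f x y| <= e / 2],
        [set y' | `|f x y' - f x y| < e / 2]).
  by split; [exact: fx|exact: continuous_dist].
move=> [x' y'] /= [/(_ y') h1 h2].
have := ler_distD (f x y') (f x' y') (f x y); lra.
Qed.

Lemma quasi_continuous2P (R : realType) (X Y : topologicalType) (f : X * Y -> R) :
  quasi_continuous f <-> quasi_continuous2 (fun x y => f (x, y)).
Proof.
split=> [qf x y U V e xU yV e0|qf [x y] A W nA [[U V] /= [xU yV] UVW]].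
  have [||Q [oQ [[x1 y1] Q1] QUV Qf]] :=
      qf (x, y) [set r | `|r - f (x, y)| < e] (U `*` V).
  - by apply: filterS (nbhsx_ballx (f (x, y)) e e0) => r; rewrite -ball_normE /= distrC.
  - by exists (U, V).
  have /(_ (x1, y1) Q1)[[A B] /= [xA yB] AB] : Q `<=` Q^° by move: oQ; rewrite openE.
  exists A^°, B^°; split.
  - by split; [exact: open_interior|exists x1].
  - by split; [exact: open_interior|exists y1].
  - move=> z /interior_subset Az.
    by have /QUV[] := AB (z, y1) (conj Az (nbhs_singleton yB)).
  - move=> z /interior_subset Bz.
    by have /QUV[] := AB (x1, z) (conj (nbhs_singleton xA) Bz).
  - move=> x' y' /interior_subset Ax' /interior_subset By'.
    by apply: Qf; exists (x', y') => //; exact: AB.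
have [e /= e0 eA] := (iffLR (nbhs_ballP _ _)) nA.
have [U' [V' [[oU' [x' Ux']] [oV' [y' Vy']] UU VV fUV]]] := qf x y U V e xU yV e0.
exists (U' `*` V'); split.
- rewrite openE => -[a b] [/= Ua Vb]; exists (U', V') => //.
  by split; exact: open_nbhs_nbhs.
- by exists (x', y').
- by move=> [a b] [/= /UU Ua /VV Vb]; exact: UVW.
- move=> _ [[a b] [/= U'a V'b] <-]; apply: eA.
  by rewrite -ball_normE /= distrC; exact: fUV.
Qed.

(** * The equivalences *)

Theorem theorem1 (R : realType) (X Y : topologicalType)
    (tX : tychonoff_space X) (tY : tychonoff_space Y)
    (pX : pseudocompact R X) (pY : pseudocompact R Y)
    (Phi : X * Y -> R) (scPhi : separately_continuous Phi) :
  [<->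
    (exists D : set Y, [/\ dense D, Gdelta D &
       forall x y, D y -> {for (x, y), continuous Phi}]);
    quasi_continuous Phi;
    compact (closure (range (phiX scPhi)));
    eberlein_compactum R (set_type (range (phiX scPhi)));
    (exists Psi : stone_cech R X * Y -> R, separately_continuous Psi /\
       forall x y, Psi (to_stone_cech R x, y) = Phi (x, y));
    (exists Psi : stone_cech R X * stone_cech R Y -> R,
       separately_continuous Psi /\
       forall x y, Psi (to_stone_cech R x, to_stone_cech R y) = Phi (x, y));
    (exists Psi : X * stone_cech R Y -> R, separately_continuous Psi /\
       forall x y, Psi (x, to_stone_cech R y) = Phi (x, y));
    eberlein_compactum R (set_type (range (phiY scPhi)));
    compact (closure (range (phiY scPhi)));
    (exists E : set X, [/\ dense E, Gdelta E &
       forall x y, E x -> {for (x, y), continuous Phi}])].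
Proof.
have [_ crX] := tX; have [_ crY] := tY.
pose f x y := Phi (x, y).
have fX y : continuous (f^~ y) by exact: scPhi.1.
have fY x : continuous (f x) by exact: scPhi.2.
have jc x y : (forall e : R, 0 < e ->
    nbhs (x, y) [set z : X * Y | `|f z.1 z.2 - f x y| < e]) ->
    {for (x, y), continuous Phi}.
  by move=> H; apply: dist_cvg => e /H; apply: filterS => -[].
have lc3 : limit_closed f -> compact (closure (range (phiX scPhi))).
  move=> lcf; have cK := limit_closed_range_compact crX crY pX pY fX fY lcf
    (phi := phiX scPhi) (fun x y => erefl).
  by rewrite -(closure_id _).1//; apply: compact_closed => //; exact: Cp_hausdorff.
have lc9 : limit_closed (fun y x => f x y) -> compact (closure (range (phiY scPhi))).
  move=> lcf; have cK := limit_closed_range_compact crY crX pY pX fY fX lcf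
    (phi := phiY scPhi) (fun x y => erefl).
  by rewrite -(closure_id _).1//; apply: compact_closed => //; exact: Cp_hausdorff.
have lc_swap : limit_closed f -> limit_closed (fun y x => f x y).
  exact: limit_closed_swap.
have lc_swap' : limit_closed (fun y x => f x y) -> limit_closed f.
  exact: (limit_closed_swap crX pY pX fY fX).
tfae.
- move=> [D [dD _ Dc]]; apply/quasi_continuous2P.
  apply: (dense_joint_quasi fY dD) => x y e Dy e0.
  by apply: filterS (cvg_dist _ (Dc x y Dy) e0) => -[].
- move=> /quasi_continuous2P qf; apply: lc3.
  exact: (quasi_limit_closed crX crY pX pY fX fY qf).
- move=> cK; apply: (limit_closed_range_eberlein crX crY pX pY fX fY) => //.
  apply: (compact_limit_closed (t := phiX scPhi)
    (g := fun k y => (k : continuousType Y R) y) cK) => //.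
  + by move=> x; apply: subset_closure; exists x.
  + by move=> y; exact: Cp_eval_continuous.
  + by move=> k; exact: cts_fun.
- move=> [cK _].
  have lcf : limit_closed f.
    apply: (compact_limit_closed (K := set_type (range (phiX scPhi)))
      (t := fun x => exist _ (phiX scPhi x) (mem_set (ex_intro2 _ _ x Logic.I erefl)))
      (g := fun k y => (set_val k : continuousType Y R) y) cK) => //.
    + move=> y k; apply: (@continuous_comp _ _ _ set_val
        (fun k : Cp R Y => (k : continuousType Y R) y)).
        exact: initial_continuous.
      exact: Cp_eval_continuous.
    + by move=> k; exact: cts_fun.
  have [g [gX gY gE]] := limit_closed_extension pX fX lcf.
  by exists (fun z => g z.1 z.2).
(* Compactness of [stone_cech R X] makes the rows of [Psi] limit closed; after exchanging the
   variables, [Psi] is extended in [Y]. *)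
- move=> [Psi [[PX PY] PE]].
  have lcg : limit_closed (fun p y => Psi (p, y)).
    exact: (@compact_limit_closed R (stone_cech R X) (stone_cech R X) Y setT _ id
      (fun p y => Psi (p, y)) (@stone_cech_compact R X)).
  have := limit_closed_swap crY (compact_pseudocompact (@stone_cech_compact R X)) pY
    PX PY lcg.
  move=> /(limit_closed_extension pY PY)[g [gX gY gE]].
  exists (fun z => g z.2 z.1); split; first by split.
  by move=> x y /=; rewrite gE.
- move=> [Psi [[PX PY] PE]]; exists (fun z => Psi (to_stone_cech R z.1, z.2)).
  split => //; split => [q x|x] /=; last exact: PY.
  apply: (@continuous_comp _ _ _ (to_stone_cech R) (fun p => Psi (p, q))).
    exact: to_stone_cech_continuous.
  exact: PX.
- move=> [Psi [[PX PY] PE]].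
  apply: (limit_closed_range_eberlein crY crX pY pX fY fX) => //.
  exact: (@compact_limit_closed R Y (stone_cech R Y) X setT _ (to_stone_cech R)
    (fun q x => Psi (x, q)) (@stone_cech_compact R Y)).
- move=> [cK _]; apply: lc9.
  apply: (compact_limit_closed (K := set_type (range (phiY scPhi)))
    (t := fun x => exist _ (phiY scPhi x) (mem_set (ex_intro2 _ _ x Logic.I erefl)))
    (g := fun k y => (set_val k : continuousType X R) y) cK) => //.
  + move=> y k; apply: (@continuous_comp _ _ _ set_val
      (fun k : Cp R X => (k : continuousType X R) y)).
      exact: initial_continuous.
    exact: Cp_eval_continuous.
  + by move=> k; exact: cts_fun.
(* Compactness on the side of [Y] is transferred to rows over [X], where Namioka's argument provides
   [E]. *)
- move=> cK.
  have lcf : limit_closed f.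
    apply: lc_swap'.
    apply: (compact_limit_closed (t := phiY scPhi)
      (g := fun k y => (k : continuousType X R) y) cK) => //.
    + by move=> x; apply: subset_closure; exists x.
    + by move=> y; exact: Cp_eval_continuous.
    + by move=> k; exact: cts_fun.
  have [E [dE GE EP]] := uniform_continuity_points crX crY pX pY fX fY lcf.
  exists E; split => // x y Ex; apply: jc => e e0.
  by apply: uniform_joint_continuous => // e' e'0; exact: EP.
(* Joint continuity over [E] gives quasi-continuity, hence [limit_closed] in both variables, and
   Namioka's argument on [Y] provides [D]. *)
- move=> [E [dE _ Ec]].
  have lcf : limit_closed (fun y x => f x y).
    apply/lc_swap/(quasi_limit_closed crX crY pX pY fX fY)/quasi_continuous2_swap.
    apply: (dense_joint_quasi fX dE) => y x e Ex e0.
    have [[A B] /= [xA yB] AB] := cvg_dist _ (Ec x y Ex) e0.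
    by exists (B, A) => // -[y' x'] [/= By' Ax']; exact: (AB (x', y')).
  have [D [dD GD DP]] := uniform_continuity_points crY crX pY pX fY fX lcf.
  exists D; split => // x y Dy; apply: jc => e e0.
  have [[B A] /= [yB xA] AB] := uniform_joint_continuous x (fX y) (fun e => DP y e Dy) e0.
  by exists (A, B) => // -[x' y'] [/= Ax' By']; exact: (AB (y', x')).
Qed.
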